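(* Let $A\in M_n(\mathbb{Z})$ and let $\Sigma=\{F_m\}_{m=1}^\infty$ be a Følner sequence in $\mathbb{N}$. Then for a Borel probability measure $\mu$ on $\mathbb{T}^n$: (1) $\mu$ is an ergodic $\times A$-invariant measure if and only if $\lim_{m\to\infty}\frac{1}{|F_m|}\sum_{j\in F_m}\hat\mu(A^jk+l)=\hat\mu(k)\hat\mu(l)$ for all $k,l\in\mathbb{Z}^{n\times 1}$; (2) $\mu$ is a weakly mixing $\times A$-invariant measure if and only if $\lim_{m\to\infty}\frac{1}{|F_m|}\sum_{j\in F_m}|\hat\mu(A^jk+l)-\hat\mu(k)\hat\mu(l)|^2=0$ for all $k,l\in\mathbb{Z}^{n\times 1}$; (3) $\mu$ is a strongly mixing $\times A$-invariant measure if and only if $\lim_{j\to\infty}\hat\mu(A^jk+l)=\hat\mu(k)\hat\mu(l)$ for all $k,l\in\mathbb{Z}^{n\times 1}$.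
   Context: $\mathbb{N}=\{0,1,2,\dots\}$, $A^0=I_n$. Identify $\mathbb{T}^n$ with $\mathbb{R}^n/\mathbb{Z}^n$ via $(x_1,\dots,x_n)+\mathbb{Z}^n\mapsto(e^{2\pi i x_1},\dots,e^{2\pi i x_n})$; $T_A(x+\mathbb{Z}^n)=xA+\mathbb{Z}^n$ for row vectors $x\in\mathbb{R}^n$, and $\mu$ is $\times A$-invariant if it is $T_A$-invariant. For $k=(k_1,\dots,k_n)^T\in\mathbb{Z}^{n\times 1}$ and $z\in\mathbb{T}^n$, $z^k=z_1^{k_1}\cdots z_n^{k_n}$ and $\hat\mu(k)=\int_{\mathbb{T}^n}z^k\,d\mu(z)$. A $T$-invariant $\mu$ is ergodic if every Borel $F$ with $T^{-1}F=F$ has $\mu(F)\in\{0,1\}$; weakly mixing if $\mu\times\mu$ is ergodic for $T\times T$; strongly mixing if $\lim_{j\to\infty}\mu(T^{-j}F\cap G)=\mu(F)\mu(G)$ for all Borel $F,G$. A Følner sequence in $\mathbb{N}$ is a sequence $\{F_m\}$ of nonempty finite subsets of $\mathbb{N}$ with $\lim_{m\to\infty}|(F_m+m')\,\Delta\,F_m|/|F_m|=0$ for every $m'\in\mathbb{N}$. *)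

(* Defs.v *)
From HB Require Import structures.
From mathcomp Require Import all_boot all_order all_algebra finmap.
From mathcomp Require Import all_classical all_reals all_analysis.
From mathcomp Require Import complex.
Import Order.TTheory GRing.Theory Num.Theory ComplexField.
Import numFieldNormedType.Exports.
Local Open Scope classical_set_scope.
Local Open Scope ring_scope.

(* Points of R^n are row vectors x : 'rV[R]_n.  The torus T^n = R^n/Z^n is
   represented by R^n equipped with the sigma-algebra of Z^n-periodic Borel sets,
   i.e. the sigma-algebra generated by the Z^n-periodic open subsets of R^n
   (these are exactly the preimages of the open sets of T^n under the quotient
   map, so measurable sets / measures on this space correspond exactly to Borel
   sets / Borel measures on T^n). *)
Definition periodic_open (R : realType) (n : nat) : set (set 'rV[R]_n) :=
  [set U | open U /\
     forall (x : 'rV[R]_n) (v : 'rV[int]_n), U x <-> U (x + map_mx intr v)].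

Definition torus (R : realType) (n : nat) := g_sigma_algebraType (periodic_open R n).

Definition TA (R : realType) {n : nat} (A : 'M[int]_n) : torus R n -> torus R n :=
  fun x : 'rV[R]_n => x *m map_mx intr A.

Definition pairing {R : realType} {n : nat} (x : 'rV[R]_n) (k : 'cV[int]_n) : R :=
  (x *m map_mx intr k) 0 0.

(* Fourier coefficient  mu^(k) = \int z^k dmu(z),  z^k = exp(2 pi i x.k) *)
Definition fourier {R : realType} {n : nat} (mu : {measure set (torus R n) -> \bar R})
  (k : 'cV[int]_n) : R[i] :=
  Complex (Rintegral mu setT (fun x : torus R n => cos (2 * pi * pairing x k)))
          (Rintegral mu setT (fun x : torus R n => sin (2 * pi * pairing x k))).

Definition ccvg {R : realType} (u : nat -> R[i]) (w : R[i]) : Prop :=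
  (fun m => Normc.normc (u m - w)) @ \oo --> (0 : R).

Definition map_invariant {d} {X : measurableType d} {R : realType}
  (T : X -> X) (mu : set X -> \bar R) : Prop :=
  forall F : set X, measurable F -> mu (T @^-1` F) = mu F.

Definition map_ergodic {d} {X : measurableType d} {R : realType}
  (T : X -> X) (mu : set X -> \bar R) : Prop :=
  forall F : set X, measurable F -> T @^-1` F = F -> mu F = 0%E \/ mu F = 1%E.

Definition map_weakly_mixing {d} {X : measurableType d} {R : realType}
  (T : X -> X) (mu : set X -> \bar R) : Prop :=
  map_ergodic (fun p : X * X => (T p.1, T p.2)) (mu \x mu)%E.

Definition map_strongly_mixing {d} {X : measurableType d} {R : realType}
  (T : X -> X) (mu : set X -> \bar R) : Prop :=
  forall F G : set X, measurable F -> measurable G ->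
    (fun j => mu ((iter j T) @^-1` F `&` G)) @ \oo --> (mu F * mu G)%E.

(* Folner sequence in N (indexed from 0 instead of 1) *)
Definition shiftf (S : {fset nat}) (m' : nat) : {fset nat} :=
  [fset (x + m')%N | x in S]%fset.

Definition Folner (R : realType) (F : nat -> {fset nat}) : Prop :=
  (forall m, F m != fset0) /\
  forall m' : nat,
    (fun m => (#|` ((shiftf (F m) m' `\` F m) `|` (F m `\` shiftf (F m) m'))%fset|%:R
               / #|` F m|%:R : R)) @ \oo --> (0 : R).

(* Main.v *)
Require Import Defs.
From HB Require Import structures.
From mathcomp Require Import all_boot all_order all_algebra finmap.
From mathcomp Require Import all_classical all_reals all_analysis.
From mathcomp Require Import complex.
From mathcomp Require Import measurable_realfun ring lra.
Import Order.TTheory GRing.Theory Num.Theory ComplexField.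
Import numFieldNormedType.Exports.
Local Open Scope classical_set_scope.
Local Open Scope ring_scope.

(* Let [c_j(f, g) = \int (f o T^j) g - \int f \int g].  Since
   [e_k o T_A^j = e_(A^j k)], the three Fourier conditions say that the sequences
   [c_j(f, g)] are null, for [f], [g] trigonometric, in one of three modes:
   averages tending to 0 along the Folner sequence, averages of absolute values
   tending to 0, or the sequence itself tending to 0.  Each mode gives a space of
   sequences that is linear, closed under uniform limits and stable under the
   shift, and that contains no nonzero constant.  Taking [g = 1], shift-stability
   forces [\int e_k o T = \int e_k]; as the trigonometric functions generate the
   Borel sets, the functional monotone class theorem then gives both the
   invariance of [mu] and the nullity of [c_j(1_B, 1_C)] for all Borel [B], [C].

   Strong mixing is this nullity by definition.  Ergodicity follows from it by
   taking [B = C] invariant, and implies it by the mean ergodic theorem along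
   Folner sequences.  For weak mixing, both directions are obtained by applying
   these facts to [T x T]: its correlations on centered tensors [f (x) f] are the
   squares [c_j(f, g)^2], and rectangles generate the product sigma-algebra. *)

(** * Functional monotone classes *)

(** Closure is under uniformly bounded pointwise limits, which is exactly what dominated convergence
    handles. Membership is inductive, so that properties of [S] spread by induction. The zero
    function is not a generator; it arises as [-f + f]. *)
Inductive mcl {R : realType} {Y : Type} (S : set (Y -> R)) : (Y -> R) -> Prop :=
| mcl_base f : S f -> mcl S f
| mcl_lin a f g : mcl S f -> mcl S g -> mcl S (fun x => a * f x + g x)
| mcl_lim (u : nat -> Y -> R) f (M : R) : (forall n, mcl S (u n)) ->
    (forall n x, `|u n x| <= M) -> (forall x, u ^~ x @ \oo --> f x) -> mcl S f.

Lemma cvg_seqP {R : realType} (u : nat -> R) (l : R) :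
  u @ \oo --> l <->
  forall e, 0 < e -> exists N, forall n, (N <= n)%N -> `|u n - l| <= e.
Proof.
split=> [/cvgrPdist_le ul e /ul [N _ uN]|ul].
  by exists N => n Nn; rewrite distrC; exact: uN.
by apply/cvgrPdist_le => e /ul [N uN]; exists N => // n /= Nn; rewrite distrC; exact: uN.
Qed.

Lemma cvg_seq_le {R : realType} (v u : nat -> R) (l : R) :
  v @ \oo --> (0 : R) -> (forall n, `|u n - l| <= v n) -> u @ \oo --> l.
Proof.
move=> /cvg_seqP v0 uv; apply/cvg_seqP => e /v0[N vN]; exists N => n /vN.
by rewrite subr0; apply: le_trans; rewrite (le_trans (uv n))// ler_norm.
Qed.

Lemma cvg_norm_le {R : realType} (u : nat -> R) (l M : R) :
  (forall n, `|u n| <= M) -> u @ \oo --> l -> `|l| <= M.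
Proof.
move=> uM ul; have nl : (fun n => `|u n|) @ \oo --> `|l| by exact: cvg_norm.
rewrite -(cvg_lim _ nl)//; apply: limr_le; first by apply/cvg_ex; exists `|l|.
by apply: nearW => n; exact: uM.
Qed.

Section monotone_class.
Context {R : realType} {Y : Type} (S : set (Y -> R)).
Hypothesis S_bounded : forall f, S f -> exists M : R, forall x, `|f x| <= M.
Hypothesis S1 : mcl S (fun=> 1).
Hypothesis SM : forall f g, S f -> S g -> mcl S (fun x => f x * g x).

Lemma mcl_bounded f : mcl S f -> exists M : R, forall x, `|f x| <= M.
Proof.
elim=> [g /S_bounded//|a g h _ [M gM] _ [N hN]|u g M _ _ uM ug].
  exists (`|a| * M + N) => x; rewrite (le_trans (ler_normD _ _))// normrM.
  by rewrite lerD// ler_wpM2l.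
by exists M => x; exact: cvg_norm_le (uM ^~ x) (ug x).
Qed.

Lemma mclZ a f : mcl S f -> mcl S (fun x => a * f x).
Proof.
move=> Sf; have S0 := mcl_lin _ (-1) _ _ Sf Sf.
have := mcl_lin _ a _ _ Sf S0; congr mcl; apply/funext => x; ring.
Qed.

Lemma mclD f g : mcl S f -> mcl S g -> mcl S (fun x => f x + g x).
Proof.
by move=> Sf Sg; have := mcl_lin _ 1 _ _ Sf Sg; congr mcl; apply/funext => x; ring.
Qed.

Lemma mcl_cst a : mcl S (fun=> a).
Proof. by have := mclZ a _ S1; congr mcl; apply/funext => x; ring. Qed.

(** The usual bootstrap: with one factor in [S], induct on the other; then let the first factor
    range over the whole class. Boundedness of the fixed factor keeps the products uniformly bounded
    in the limit case. *)
Lemma mclM f g : mcl S f -> mcl S g -> mcl S (fun x => f x * g x).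
Proof.
move=> + Sg; elim=> {f} [f Sf|a f h _ fg _ hg|u f M _ ug uM uf].
- elim: Sg => {g} [g Sg|a g h _ fg _ fh|u g M _ fu uM ug]; first exact: SM.
    have := mcl_lin _ a _ _ fg fh; congr mcl; apply/funext => x; ring.
  have [N fN] := S_bounded _ Sf.
  apply: (mcl_lim _ (fun n x => f x * u n x) _ (N * M)) => // [n x|x].
    by rewrite normrM ler_pM.
  by apply: cvgM => //; exact: cvg_cst.
- have := mcl_lin _ a _ _ fg hg; congr mcl; apply/funext => x; ring.
- have [N gN] := mcl_bounded _ Sg.
  apply: (mcl_lim _ (fun n x => u n x * g x) _ (M * N)) => // [n x|x].
    by rewrite normrM ler_pM.
  by apply: cvgM => //; exact: cvg_cst.
Qed.

Lemma mcl_prod {I : Type} (r : seq I) (f : I -> Y -> R) :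
  (forall i, mcl S (f i)) -> mcl S (fun x => \prod_(i <- r) f i x).
Proof.
move=> Sf; elim: r => [|i r IH].
  by congr mcl: S1; apply/funext => x; rewrite big_nil.
by congr mcl: (mclM _ _ (Sf i) IH); apply/funext => x; rewrite big_cons.
Qed.

End monotone_class.

(* Newton's iteration for [sgr]: on [[-1, 1]] the iterates of
   q |-> (3q - q^3)/2 converge pointwise to the sign. *)
Definition sgn_step {R : realType} (q : R) : R := (3 * q - q ^+ 3) / 2.

Lemma sgn_stepN {R : realType} (q : R) : sgn_step (- q) = - sgn_step q.
Proof. by rewrite /sgn_step; field. Qed.

Lemma iter_sgn_stepN {R : realType} (q : R) n :
  iter n sgn_step (- q) = - iter n sgn_step q.
Proof. by elim: n => [|n IH] //=; rewrite IH sgn_stepN. Qed.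

(** One step from [r] gives [1 - sgn_step r = (1 - r) (1 - (r + r^2) / 2)]. Since the iterates stay
    above [q], the second factor is at most [1 - q / 2], whence geometric convergence to 1. *)
Lemma iter_sgn_step_bounds {R : realType} (q : R) n : 0 <= q <= 1 ->
  [/\ q <= iter n sgn_step q, iter n sgn_step q <= 1 &
      1 - iter n sgn_step q <= (1 - q / 2) ^+ n].
Proof.
move=> q01; elim: n => [|n [IH1 IH2 IH3]] /=; first by split; rewrite ?expr0; lra.
set r := iter n sgn_step q in IH1 IH2 IH3 *; rewrite /sgn_step; split.
- have : 0 <= r * (1 - r) * (1 + r) by rewrite !mulr_ge0//; lra.
  by move=> H; have -> : (3 * r - r ^+ 3) / 2 = r + r * (1 - r) * (1 + r) / 2;
    [by field|lra].
- have : 0 <= (1 - r) ^+ 2 * (2 + r) by rewrite mulr_ge0 ?sqr_ge0//; lra.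
  by move=> H; have -> : (3 * r - r ^+ 3) / 2 = 1 - (1 - r) ^+ 2 * (2 + r) / 2;
    [by field|lra].
- have -> : 1 - (3 * r - r ^+ 3) / 2 = (1 - r) * (1 - (r + r ^+ 2) / 2) by field.
  have r1 : 0 <= 1 - r ^+ 2.
    have -> : 1 - r ^+ 2 = (1 - r) * (1 + r) by ring.
    by rewrite mulr_ge0//; lra.
  have r0 := sqr_ge0 r.
  by rewrite (exprSr (1 - q / 2)); apply: ler_pM => //; lra.
Qed.

Lemma cvg_iter_sgn_step {R : realType} (q : R) : `|q| <= 1 ->
  (fun n => iter n sgn_step q) @ \oo --> Num.sg q.
Proof.
wlog q0 : q / 0 <= q => [pos q1|q1].
  have [|q0] := leP 0 q => [/pos/(_ q1)//|].
  have := pos (- q); rewrite oppr_ge0 normrN => /(_ (ltW q0) q1) /cvgN.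
  rewrite sgrN opprK; apply: cvg_trans; rewrite (_ : - _ = fun n => iter n sgn_step q)//.
  by apply/funext => n; rewrite opprfctE iter_sgn_stepN opprK.
have q01 : 0 <= q <= 1 by rewrite q0 -(ger0_norm q0).
have [->|q_neq0] := eqVneq q 0.
  rewrite sgr0 (_ : (fun _ => _) = cst 0); first exact: cvg_cst.
  by apply/funext; elim=> //= n ->; rewrite /sgn_step /=; field.
have q_gt0 : 0 < q by rewrite lt_def q_neq0.
rewrite gtr0_sg//.
apply: (cvg_seq_le (fun n => (1 - q / 2) ^+ n)) => [|n].
  by apply: cvg_expr; rewrite ltr_norml; lra.
by have [? ? ?] := iter_sgn_step_bounds q n q01; rewrite distrC ger0_norm; lra.
Qed.

Lemma normr_iter_sgn_step {R : realType} (q : R) n : `|q| <= 1 ->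
  `|iter n sgn_step q| <= 1.
Proof.
wlog q0 : q / 0 <= q => [pos q1|q1].
  have [|q0] := leP 0 q => [/pos/(_ q1)//|].
  have := pos (- q); rewrite oppr_ge0 normrN => /(_ (ltW q0) q1).
  by rewrite iter_sgn_stepN normrN.
have q01 : 0 <= q <= 1 by rewrite q0 -(ger0_norm q0).
by have [? ? _] := iter_sgn_step_bounds q n q01; rewrite ler_norml; lra.
Qed.

Section monotone_class_sets.
Context {R : realType} {Y : Type} (S : set (Y -> R)).
Hypothesis S_bounded : forall f, S f -> exists M : R, forall x, `|f x| <= M.
Hypothesis S1 : mcl S (fun=> 1).
Hypothesis SM : forall f g, S f -> S g -> mcl S (fun x => f x * g x).

(** After scaling [f] into [[-1, 1]], the iterates of [sgn_step] are polynomials in [f], hence in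
    the class, and converge boundedly to [sg f]. The indicator is then [(sg f + (sg f)^2) / 2]. This
    explicit iteration stands in for Weierstrass approximation. *)
Lemma mcl_indic_gt0 f : mcl S f -> mcl S (\1_[set x | 0 < f x] : Y -> R).
Proof.
move=> Sf; have [M0 fM0] := mcl_bounded _ S_bounded _ Sf.
have [M M_gt0 fM] : exists2 M : R, 0 < M & forall x, `|f x| <= M.
  exists (`|M0| + 1) => [|x]; first by rewrite ltr_wpDl.
  by rewrite (le_trans (fM0 x))// (le_trans (ler_norm _))// lerDl.
pose u n x := iter n sgn_step (M^-1 * f x).
have f1 x : `|M^-1 * f x| <= 1.
  by rewrite normrM gtr0_norm ?invr_gt0// ler_pdivrMl// mulr1.
have Su n : mcl S (u n).
  elim: n => [|n Su]; first exact: mclZ.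
  have uu := mclM _ S_bounded SM _ _ Su Su.
  have := mcl_lin _ (3 / 2) _ _ Su (mclZ _ (- 2^-1) _ (mclM _ S_bounded SM _ _ Su uu)).
  congr mcl; apply/funext => x; rewrite /u /= /sgn_step.
  set r := iter _ _ _; by field.
have Ssg : mcl S (fun x => Num.sg (f x)).
  apply: (mcl_lim _ u _ 1) => // [n x|x]; first exact: normr_iter_sgn_step.
  have sgM : Num.sg M^-1 = 1 by rewrite gtr0_sg ?invr_gt0.
  by rewrite -[Num.sg (f x)]mul1r -sgM -sgrM; exact: cvg_iter_sgn_step.
have := mclZ _ 2^-1 _ (mclD _ _ _ Ssg (mclM _ S_bounded SM _ _ Ssg Ssg)).
congr mcl; apply/funext => x; rewrite indicE.
have -> : (x \in [set x | 0 < f x]) = (0 < f x) by apply/idP/idP => [/set_mem//|?]; exact/mem_set.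
by case: (sgrP (f x)) => _ /=; field.
Qed.

Lemma mcl_indic_sigma_algebra :
  sigma_algebra setT [set A | mcl S (\1_A : Y -> R)].
Proof.
have SC A : mcl S (\1_A : Y -> R) -> mcl S (\1_(~` A) : Y -> R).
  move=> SA; have := mcl_lin _ (-1) _ _ SA S1.
  by congr mcl; apply/funext => x; rewrite !indicE in_setC; case: (x \in A) => /=; ring.
split => [||F SF] /=.
- by have := mclZ _ 0 _ S1; congr mcl; apply/funext => x; rewrite indic0 mul0r.
- by move=> A SA; rewrite setTD; exact: SC.
(* The complement of the union is the limit of finite products of indicators of complements, so
   multiplicativity of the class handles unions of sets that are not disjoint. *)
- rewrite -(setCK (\bigcup_n F n)); apply: (SC (~` _)).
  apply: (mcl_lim _ (fun n x => \prod_(i < n) \1_(~` F i) x) _ 1).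
  + by move=> n; apply: (mcl_prod _ S_bounded S1 SM (index_enum 'I_n) (fun i => \1_(~` F i))) => i; exact/SC/SF.
  + move=> n x; rewrite normr_prod; apply: prodr_ile1 => i _.
    by rewrite normr_ge0 indicE; case: (_ \in _); rewrite /= ?normr1 ?normr0 ?ler01 ?lexx.
  + move=> x; rewrite indicE.
    have [[n _ Fnx]|nF] := pselect ((\bigcup_n F n) x); last first.
      rewrite mem_set// (_ : (fun _ => _) = cst 1); first exact: cvg_cst.
      apply/funext => n; rewrite big1// => i _; rewrite indicE mem_set// => Fix.
      by apply: nF; exists (val i).
    rewrite memNset; last by apply; exists n.
    apply: (cvg_near_cst (0 : R)); exists n.+1 => // m /= nm; apply/eqP.
    rewrite (bigD1 (Ordinal nm))//= indicE memNset ?mul0r//; exact: contraPnot.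
Qed.

End monotone_class_sets.

(** * Bounded measurable functions and their means *)

Section bounded_measurable.
Context {d} {Y : measurableType d} {R : realType}.
Implicit Types f g : Y -> R.

(** The bound holds everywhere, not just almost everywhere, so composing with a measurable map
    preserves the class whether or not the map preserves the measure. *)
Definition bmeas f := measurable_fun setT f /\ exists M : R, forall x, `|f x| <= M.

Lemma bmeas_bound f : bmeas f -> exists2 M : R, 0 < M & forall x, `|f x| <= M.
Proof.
move=> [_ [M fM]]; exists (`|M| + 1) => [|x]; first by rewrite ltr_wpDl.
by rewrite (le_trans (fM x))// (le_trans (ler_norm _))// lerDl.
Qed.

Lemma bmeas_cst a : bmeas (fun=> a).
Proof. by split; [exact: measurable_cst|exists `|a|]. Qed.

Lemma bmeas_lin a f g : bmeas f -> bmeas g -> bmeas (fun x => a * f x + g x).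
Proof.
move=> [mf [M fM]] [mg [N gN]]; split.
  by apply: measurable_funD => //; apply: measurable_funM => //; exact: measurable_cst.
exists (`|a| * M + N) => x; rewrite (le_trans (ler_normD _ _))// normrM.
by rewrite lerD// ler_wpM2l.
Qed.

Lemma bmeasD f g : bmeas f -> bmeas g -> bmeas (fun x => f x + g x).
Proof. by move=> bf bg; congr bmeas: (bmeas_lin 1 _ _ bf bg); apply/funext => x; ring. Qed.

Lemma bmeasZ a f : bmeas f -> bmeas (fun x => a * f x).
Proof.
move=> bf; congr bmeas: (bmeas_lin a _ _ bf (bmeas_cst 0)); apply/funext => x; ring.
Qed.

Lemma bmeasB f g : bmeas f -> bmeas g -> bmeas (fun x => f x - g x).
Proof. by move=> bf bg; congr bmeas: (bmeas_lin (-1) _ _ bg bf); apply/funext => x; ring. Qed.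

Lemma bmeasM f g : bmeas f -> bmeas g -> bmeas (fun x => f x * g x).
Proof.
move=> [mf [M fM]] [mg [N gN]]; split; first exact: measurable_funM.
by exists (M * N) => x; rewrite normrM ler_pM.
Qed.

Lemma bmeas_norm f : bmeas f -> bmeas (fun x => `|f x|).
Proof.
move=> [mf [M fM]]; split; first exact: measurableT_comp.
by exists M => x; rewrite normr_id.
Qed.

Lemma bmeas_indic (A : set Y) : measurable A -> bmeas (\1_A : Y -> R).
Proof.
move=> mA; split; first exact: measurable_indic.
by exists 1 => x; rewrite indicE; case: (_ \in _); rewrite /= ?normr1 ?normr0.
Qed.

Lemma bmeas_lim (u : nat -> Y -> R) f M : (forall n, bmeas (u n)) ->
  (forall n x, `|u n x| <= M) -> (forall x, u ^~ x @ \oo --> f x) -> bmeas f.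
Proof.
move=> bu uM uf; split.
  by apply: (@measurable_fun_cvg _ _ _ _ u) => [n|x _]; [case: (bu n)|exact: uf].
by exists M => x; exact: cvg_norm_le (uM ^~ x) (uf x).
Qed.

End bounded_measurable.

Lemma bmeas_comp {d d'} {X : measurableType d} {Y : measurableType d'}
  {R : realType} (T : X -> Y) (f : Y -> R) :
  measurable_fun setT T -> bmeas f -> bmeas (f \o T).
Proof.
by move=> mT [mf [M fM]]; split; [exact: measurableT_comp|exists M => x; exact: fM].
Qed.

Definition mean {d} {Y : measurableType d} {R : realType}
  (P : {measure set Y -> \bar R}) (f : Y -> R) : R := Rintegral P setT f.

Section mean.
Context {d} {Y : measurableType d} {R : realType} (P : probability Y R).
Implicit Types f g : Y -> R.

Lemma bmeas_integrable f : bmeas f -> P.-integrable setT (EFin \o f).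
Proof.
move=> bf; have [M M0 fM] := bmeas_bound _ bf.
apply: measurable_bounded_integrable => //; last 2 first.
- by case: bf.
- exists M; split; first exact: num_real.
  by move=> x Mx y _; exact: le_trans (fM y) (ltW Mx).
by rewrite ltey_eq fin_num_measure.
Qed.

Lemma mean_cst a : mean P (fun=> a) = a.
Proof.
rewrite /mean Rintegral_cst//; set p := (X in fine X).
by have -> : p = 1%E by [exact: probability_setT]; rewrite mulr1.
Qed.

Lemma mean_lin a f g : bmeas f -> bmeas g ->
  mean P (fun x => a * f x + g x) = a * mean P f + mean P g.
Proof.
move=> bf bg; rewrite /mean RintegralD ?RintegralZl//.
- exact: bmeas_integrable.
- exact: (bmeas_integrable _ (bmeasZ _ _ bf)).
- exact: bmeas_integrable.
Qed.

Lemma meanD f g : bmeas f -> bmeas g ->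
  mean P (fun x => f x + g x) = mean P f + mean P g.
Proof. by move=> bf bg; rewrite /mean RintegralD//; exact: bmeas_integrable. Qed.

Lemma meanB f g : bmeas f -> bmeas g ->
  mean P (fun x => f x - g x) = mean P f - mean P g.
Proof. by move=> bf bg; rewrite /mean RintegralB//; exact: bmeas_integrable. Qed.

Lemma meanZ a f : bmeas f -> mean P (fun x => a * f x) = a * mean P f.
Proof. by move=> bf; rewrite /mean RintegralZl//; exact: bmeas_integrable. Qed.

Lemma mean_le f g : bmeas f -> bmeas g -> (forall x, f x <= g x) ->
  mean P f <= mean P g.
Proof. by move=> bf bg fg; apply: le_Rintegral => //; exact: bmeas_integrable. Qed.

Lemma mean_ge0 f : (forall x, 0 <= f x) -> 0 <= mean P f.
Proof. by move=> f0; apply: Rintegral_ge0. Qed.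

Lemma mean_norm f : bmeas f -> `|mean P f| <= mean P (fun x => `|f x|).
Proof. by move=> bf; apply: le_normr_Rintegral => //; exact: bmeas_integrable. Qed.

Lemma mean_normM f g M : bmeas f -> bmeas g -> (forall x, `|g x| <= M) ->
  `|mean P (fun x => f x * g x)| <= mean P (fun x => `|f x|) * M.
Proof.
move=> bf bg gM; rewrite mulrC -meanZ; last exact: bmeas_norm.
rewrite (le_trans (mean_norm _ (bmeasM _ _ bf bg)))//; apply: mean_le.
- exact/bmeas_norm/bmeasM.
- exact/bmeasZ/bmeas_norm.
- by move=> x; rewrite normrM mulrC ler_wpM2r.
Qed.

Lemma mean_indic (A : set Y) : measurable A -> mean P (\1_A : Y -> R) = fine (P A).
Proof. by move=> mA; rewrite /mean /Rintegral integral_indic// setIT. Qed.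

Lemma ae_eq_mean f g : bmeas f -> bmeas g -> {ae P, forall x, f x = g x} ->
  mean P f = mean P g.
Proof.
move=> [mf _] [mg _] fg; congr fine; apply: ae_eq_integral => //.
- exact/measurable_EFinP.
- exact/measurable_EFinP.
- by apply: filterS fg => x + _ => ->.
Qed.

Lemma mean_cvg (u : nat -> Y -> R) f M : (forall n, bmeas (u n)) -> bmeas f ->
  (forall n x, `|u n x| <= M) -> {ae P, forall x, u ^~ x @ \oo --> f x} ->
  (fun n => mean P (fun x => `|u n x - f x|)) @ \oo --> (0 : R).
Proof.
move=> bu bf uM uf.
have [|||||_ + _] := @dominated_convergence _ _ _ P setT measurableT
    (fun n x => (u n x)%:E) (EFin \o f) (fun=> M%:E).
- by move=> n; apply/measurable_EFinP; case: (bu n).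
- by apply/measurable_EFinP; case: bf.
- by apply: filterS uf => x ux _; apply: cvg_EFin => //; exact: nearW.
- exact: (bmeas_integrable _ (bmeas_cst M)).
- by apply: aeW => x n _; rewrite lee_fin.
by move=> /fine_cvgP[_].
Qed.

Lemma mean_comp (T : Y -> Y) f : measurable_fun setT T -> map_invariant T P ->
  bmeas f -> mean P (f \o T) = mean P f.
Proof.
move=> mT invT bf; rewrite /mean /Rintegral; congr fine.
have := @integral_pushforward _ _ _ _ R T mT P setT (EFin \o f).
rewrite preimage_setT => <-//.
- by apply: eq_measure_integral => A mA _; exact: invT.
- by apply/measurable_EFinP; case: bf.
- by apply: bmeas_integrable; exact: bmeas_comp.
Qed.

End mean.

(** * Correlations *)

(** Shift-stability is asked of bounded sequences only: for Folner averages, shifting costs a sup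
    bound times the relative size of a boundary. *)
Record null_mode {R : realType} (Z : (nat -> R) -> Prop) : Prop := NullMode {
  null_lin : forall a s t, Z s -> Z t -> Z (fun j => a * s j + t j);
  null_unif : forall s, (forall e, 0 < e ->
    exists2 t, Z t & forall j, `|s j - t j| <= e) -> Z s;
  null_cst : forall c, Z (fun=> c) -> c = 0;
  null_shift : forall s M, (forall j, `|s j| <= M) -> Z s -> Z (fun j => s j.+1) }.

Lemma map_invariant_iter {d} {Y : measurableType d} {R : realType}
    (T : Y -> Y) (P : set Y -> \bar R) j :
  measurable_fun setT T -> map_invariant T P ->
  measurable_fun setT (iter j T) /\ map_invariant (iter j T) P.
Proof.
move=> mT invT; elim: j => [|j [mTj invTj]].
  by split => [|F mF]; [exact: measurable_id|rewrite preimage_id].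
split=> [|F mF]; first exact: measurableT_comp.
rewrite (_ : iter j.+1 T @^-1` F = iter j T @^-1` (T @^-1` F))// invTj ?invT//.
by rewrite -[X in measurable X]setTI; exact: mT.
Qed.

Definition corr {d} {Y : measurableType d} {R : realType}
    (P : {measure set Y -> \bar R}) (T : Y -> Y) (f g : Y -> R) (j : nat) : R :=
  mean P (fun x => f (iter j T x) * g x) - mean P f * mean P g.

Section correlation.
Context {d} {Y : measurableType d} {R : realType} (P : probability Y R).
Variable T : Y -> Y.
Hypothesis mT : measurable_fun setT T.
Implicit Types f g h : Y -> R.

Lemma bmeas_iter f j : bmeas f -> bmeas (fun x => f (iter j T x)).
Proof.
move=> bf; apply: bmeas_comp bf.
by elim: j => [|j IH]; [exact: measurable_id|exact: measurableT_comp].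
Qed.

Lemma corr_linl a f h g j : bmeas f -> bmeas h -> bmeas g ->
  corr P T (fun x => a * f x + h x) g j = a * corr P T f g j + corr P T h g j.
Proof.
move=> bf bh bg; rewrite /corr mean_lin//.
have -> : (fun x => (a * f (iter j T x) + h (iter j T x)) * g x) =
    (fun x => a * (f (iter j T x) * g x) + h (iter j T x) * g x).
  by apply/funext => x; ring.
by rewrite mean_lin; [ring| |]; apply: bmeasM => //; exact: bmeas_iter.
Qed.

Lemma corr_linr a f h g j : bmeas f -> bmeas h -> bmeas g ->
  corr P T g (fun x => a * f x + h x) j = a * corr P T g f j + corr P T g h j.
Proof.
move=> bf bh bg; rewrite /corr mean_lin//.
have -> : (fun x => g (iter j T x) * (a * f x + h x)) =
    (fun x => a * (g (iter j T x) * f x) + g (iter j T x) * h x).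
  by apply/funext => x; ring.
by rewrite mean_lin; [ring| |]; apply: bmeasM => //; exact: bmeas_iter.
Qed.

(** Obtained before invariance is assumed: in [null_trigP] this bound is what permits the shift from
    which invariance is deduced. *)
Lemma corr_bounded f g : bmeas f -> bmeas g ->
  exists M, forall j, `|corr P T f g j| <= M.
Proof.
move=> bf bg; have [K K0 gK] := bmeas_bound _ bg; have [M M0 fM] := bmeas_bound _ bf.
exists (M * K + `|mean P f * mean P g|) => j; have bfj := bmeas_iter _ j bf.
rewrite (le_trans (ler_normB _ _))// lerD2r (le_trans (mean_normM _ _ _ _ bfj bg gK))//.
rewrite ler_wpM2r//; first exact: ltW.
rewrite -[leRHS](mean_cst P); apply: mean_le => //; first exact: bmeas_norm.
exact: bmeas_cst.
Qed.

Hypothesis invT : map_invariant T P.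

Lemma mean_iter f j : bmeas f -> mean P (fun x => f (iter j T x)) = mean P f.
Proof.
move=> bf; have [mTj invTj] := map_invariant_iter T P j mT invT.
exact: mean_comp mTj invTj bf.
Qed.

(** An [L^1] bound in one argument and a sup bound in the other, uniform in [j]: by invariance, [f]
    composed with [T^j] keeps its [L^1] norm. Hence [L^1] approximation of [f] approximates the
    whole sequence uniformly. [corr_boundr] does the same for the second argument. *)
Lemma corr_bound f g j : bmeas f -> bmeas g ->
  forall M, (forall x, `|g x| <= M) ->
  `|corr P T f g j| <= 2 * (mean P (fun x => `|f x|) * M).
Proof.
move=> bf bg M gM; rewrite /corr (le_trans (ler_normB _ _))// mulr_natl mulr2n.
have bfj := bmeas_iter _ j bf; apply: lerD.
  rewrite (le_trans (mean_normM _ _ _ _ bfj bg gM))//.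
  by rewrite (mean_iter (fun x => `|f x|)) //; exact: bmeas_norm.
rewrite -meanZ// (_ : (fun x => mean P f * g x) = (fun x => cst (mean P f) x * g x))//.
rewrite (le_trans (mean_normM _ _ _ _ (bmeas_cst (mean P f)) bg gM))// mean_cst.
have M0 : 0 <= M by exact: le_trans (gM point).
by rewrite ler_wpM2r// mean_norm.
Qed.

Lemma corr_boundr f g j : bmeas f -> bmeas g ->
  forall M, (forall x, `|f x| <= M) ->
  `|corr P T f g j| <= 2 * (mean P (fun x => `|g x|) * M).
Proof.
move=> bf bg M fM; rewrite /corr (le_trans (ler_normB _ _))// mulr_natl mulr2n.
have bfj := bmeas_iter _ j bf; apply: lerD.
  by under eq_fun do rewrite mulrC; exact: mean_normM.
rewrite mulrC -meanZ// (_ : (fun x => mean P g * f x) = (fun x => cst (mean P g) x * f x))//.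
rewrite (le_trans (mean_normM _ _ _ _ (bmeas_cst (mean P g)) bf fM))// mean_cst.
have M0 : 0 <= M by exact: le_trans (fM point).
by rewrite ler_wpM2r// mean_norm.
Qed.

Lemma mcl_bmeas (S : set (Y -> R)) : S `<=` bmeas -> mcl S `<=` bmeas.
Proof.
move=> Sb f; elim=> {f} [f /Sb//|a f g _ bf _ bg|u f M _ bu uM uf].
  exact: bmeas_lin.
exact: bmeas_lim bu uM uf.
Qed.

Variables (Z : (nat -> R) -> Prop) (nullZ : null_mode Z).

(** Dominated convergence makes the [L^1] distance small, the last hypothesis turns this into
    closeness uniform in [j], and closure of [Z] under uniform limits concludes. [C] is left
    abstract so as to serve both arguments of [corr]. *)
Lemma null_mean_approx (u : nat -> Y -> R) f M (C : (Y -> R) -> nat -> R) K :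
  (forall n, bmeas (u n)) -> (forall n x, `|u n x| <= M) ->
  (forall x, u ^~ x @ \oo --> f x) ->
  (forall n, Z (C (u n))) ->
  (forall n j, `|C f j - C (u n) j| <= mean P (fun x => `|u n x - f x|) * K) ->
  Z (C f).
Proof.
move=> bu uM uf Zu Clip; have bf := bmeas_lim _ _ _ bu uM uf.
have [e0 e1] : 0 < `|K| + 1 /\ K <= `|K| + 1.
  by split; [rewrite ltr_wpDl|rewrite (le_trans (ler_norm _))// lerDl].
apply: (null_unif _ nullZ) => e e_gt0.
have /cvg_seqP/(_ (e / (`|K| + 1))) := mean_cvg P _ _ _ bu bf uM (aeW _ uf).
rewrite divr_gt0// => /(_ isT)[n /(_ n (leqnn n))]; rewrite subr0 => En.
exists (C (u n)) => // j; rewrite (le_trans (Clip n j))//.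
have En0 : 0 <= mean P (fun x => `|u n x - f x|) by exact: mean_ge0.
rewrite (ger0_norm En0) ler_pdivlMr// in En.
by rewrite (le_trans _ En)// ler_wpM2l.
Qed.

(** Bilinearity and [L^1] continuity of [corr] carry nullity from generators to the class: first in
    [f] with a generator on the right, then in [g]. *)
Lemma corr_mcl (S : set (Y -> R)) : S `<=` bmeas ->
  (forall p q, S p -> S q -> Z (corr P T p q)) ->
  forall f g, mcl S f -> mcl S g -> Z (corr P T f g).
Proof.
move=> Sb ZS f g Sf Sg; have Sb' := mcl_bmeas _ Sb; have bf0 := Sb' _ Sf.
have ZfS : forall q, S q -> Z (corr P T f q).
  move=> q Sq; have bq := Sb _ Sq; have [K K0 qK] := bmeas_bound _ bq.
  elim: Sf {bf0} => {f} [p Sp|a f h Sf IHf Sh IHh|u f M Su Zu uM uf]; first exact: ZS.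
    rewrite (_ : corr _ _ _ _ = fun j => a * corr P T f q j + corr P T h q j).
      exact: (null_lin _ nullZ).
    by apply/funext => j; apply: corr_linl => //; exact: Sb'.
  have bu n := Sb' _ (Su n); have bf := bmeas_lim _ _ _ bu uM uf.
  apply: (null_mean_approx u f M (corr P T ^~ q) (2 * K)) => // n j.
  rewrite mulrCA distrC; apply: le_trans (corr_bound _ _ j (bmeasB _ _ (bu n) bf) bq _ qK).
  rewrite (_ : (fun x => u n x - f x) = (fun x => -1 * f x + u n x)).
    by rewrite corr_linl// mulN1r addrC.
  by apply/funext => x; ring.
have [K K0 fK] := bmeas_bound _ bf0.
elim: Sg => {g} [q|a g h Sg IHg Sh IHh|u g M Su Zu uM ug]; first exact: ZfS.
  rewrite (_ : corr _ _ _ _ = fun j => a * corr P T f g j + corr P T f h j).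
    exact: (null_lin _ nullZ).
  by apply/funext => j; apply: corr_linr => //; exact: Sb'.
have bu n := Sb' _ (Su n); have bg := bmeas_lim _ _ _ bu uM ug.
apply: (null_mean_approx u g M (corr P T f) (2 * K)) => // n j.
rewrite mulrCA distrC; apply: le_trans (corr_boundr _ _ j bf0 (bmeasB _ _ (bu n) bg) _ fK).
rewrite (_ : (fun x => u n x - g x) = (fun x => -1 * g x + u n x)).
  by rewrite corr_linr// mulN1r addrC.
by apply/funext => x; ring.
Qed.

End correlation.

(** * Almost-everywhere invariance and convergence *)

Section almost_everywhere.
Context {d} {Y : measurableType d} {R : realType} (P : probability Y R).

Lemma ae_preimage (T : Y -> Y) (Q : Y -> Prop) :
  measurable_fun setT T -> map_invariant T P ->
  {ae P, forall x, Q x} -> {ae P, forall x, Q (T x)}.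
Proof.
move=> mT invT [N [mN N0 QN]]; exists (T @^-1` N); split.
- by rewrite -[X in measurable X]setTI; exact: mT.
- by rewrite [LHS]invT.
- by move=> x /= nQ; exact: QN.
Qed.

Lemma ae_of_probability1 (G : set Y) : measurable G -> P G = 1%E ->
  {ae P, forall x, G x}.
Proof.
move=> mG PG; exists (~` G); split; first exact: measurableC.
  by rewrite [LHS]probability_setC// PG subee.
by [].
Qed.

Lemma ae_of_probability0 (G : set Y) : measurable G -> P G = 0%E ->
  {ae P, forall x, ~ G x}.
Proof. by move=> mG PG; exists G; split => // x /= /contrapT. Qed.

Lemma probability_ae_eq (G H : set Y) : measurable G -> measurable H ->
  {ae P, forall x, G x <-> H x} -> P G = P H.
Proof.
move=> mG mH GH; rewrite -[LHS]fineK ?fin_num_measure// -[RHS]fineK ?fin_num_measure//.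
congr (_%:E); rewrite -!mean_indic//; apply: ae_eq_mean; try exact: bmeas_indic.
apply: filterS GH => x GHx; rewrite !indicE; congr (_%:R); congr nat_of_bool.
by apply/idP/idP => /set_mem/GHx/mem_set.
Qed.

(* [\bigcup_J \bigcap_(j >= J) T^-j G] is exactly invariant and agrees with [G]
   almost everywhere. *)
Lemma ergodic_ae (T : Y -> Y) (G : set Y) :
  measurable_fun setT T -> map_invariant T P -> map_ergodic T P ->
  measurable G -> {ae P, forall x, G (T x) <-> G x} -> P G = 0%E \/ P G = 1%E.
Proof.
move=> mT invT ergT mG GT.
pose E := \bigcup_J \bigcap_j (iter (J + j) T @^-1` G).
have mE : measurable E.
  apply: bigcup_measurable => J _; apply: bigcapT_measurable => j.
  rewrite -[X in measurable X]setTI.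
  by have [mTj _] := map_invariant_iter T P (J + j) mT invT; exact: mTj.
have TE : T @^-1` E = E.
  apply/seteqP; split => x /= [J _ EJ].
    exists J.+1 => // j _ /=; have := EJ j I.
    by rewrite /preimage /= -iterSr.
  exists J => // j _ /=; have := EJ j.+1 I.
  by rewrite /preimage /= addnS iterSr.
have -> : P G = P E; last exact: ergT.
apply: probability_ae_eq => //.
have GTj j : {ae P, forall x, G (T (iter j T x)) <-> G (iter j T x)}.
  have [mTj invTj] := map_invariant_iter T P j mT invT.
  exact: (ae_preimage (iter j T) _ mTj invTj GT).
have := ae_foralln GTj; apply: filterS => x GTx.
have Gj j : G (iter j T x) <-> G x.
  by elim: j => //= j IH; rewrite GTx.
by split=> [Gx|[J _ /(_ 0%N I)/Gj//]]; exists 0%N => // j _; exact/Gj.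
Qed.

(** Beppo Levi: the extended-real sum [D] has integral at most [2 * C], so it is finite almost
    everywhere. The set where [D] is finite is returned as a measurable set, so that it can later be
    used for truncation. *)
Lemma ae_cvg_series (w : nat -> Y -> R) C : (forall i, bmeas (w i)) ->
  (forall i x, 0 <= w i x) -> (forall i, mean P (w i) <= C / 2 ^+ i) ->
  exists2 X : set Y, measurable X & {ae P, forall x, X x} /\
    forall x, X x -> cvgn (series (fun i => w i x)).
Proof.
move=> bw w0 wC; pose D x := (\sum_(0 <= i <oo) (w i x)%:E)%E.
have mw i : measurable_fun setT (EFin \o w i) by apply/measurable_EFinP; case: (bw i).
have w0E i x : (0 <= (w i x)%:E)%E by rewrite lee_fin.
have D0 x : (0 <= D x)%E by exact: nneseries_ge0.
have mD : measurable_fun setT D.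
  by apply: (@ge0_emeasurable_sum _ _ _ setT (fun i x => (w i x)%:E) xpredT) => i *; [exact: w0E|exact: mw].
exists [set x | (D x < +oo)%E].
  by rewrite -[X in measurable X]setTI; exact: emeasurable_fun_infty_o.
have C0 : 0 <= C.
  by have := le_trans (mean_ge0 P _ (w0 0%N)) (wC 0%N); rewrite expr0 divr1.
have sumC n : \sum_(i < n) C / 2 ^+ i = 2 * C - 2 * C / 2 ^+ n.
  elim: n => [|n IH]; first by rewrite big_ord0 expr0 divr1 subrr.
  by rewrite big_ord_recr /= IH exprS; field; rewrite expf_neq0.
have intD : P.-integrable setT D.
  apply/integrableP; split=> //.
  under eq_integral do rewrite gee0_abs//.
  rewrite integral_nneseries//.
  apply: (le_lt_trans _ (ltry (2 * C))).
  apply: lime_le; first by apply: is_cvg_nneseries => n _ _; exact: integral_ge0.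
  apply: nearW => n; rewrite big_mkord.
  rewrite (eq_bigr (fun i : 'I_n => (mean P (w i))%:E)); last first.
    move=> i _; rewrite /mean /Rintegral fineK//.
    by apply: integrable_fin_num => //; exact: bmeas_integrable.
  rewrite sumEFin lee_fin; apply: (@le_trans _ _ (\sum_(i < n) C / 2 ^+ i)).
    by apply: ler_sum => i _; exact: wC.
  rewrite sumC.
  by rewrite gerBl// divr_ge0// mulr_ge0.
split.
  apply: filterS (integrable_ae measurableT intD) => x /(_ I) /=.
  by rewrite ge0_fin_numE.
move=> x Dx; apply: nondecreasing_is_cvgn; first exact: nondecreasing_series.
exists (fine (D x)) => _ [n _ <-]; rewrite -lee_fin fineK ?ge0_fin_numE//.
rewrite /series /= -sumEFin.
exact: (@nneseries_lim_ge _ (fun i => (w i x)%:E) xpredT 0 n).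
Qed.

End almost_everywhere.

(** * The mean ergodic theorem *)

Section mean_ergodic.
Context {d} {Y : measurableType d} {R : realType} (P : probability Y R).
Variable T : Y -> Y.
Hypothesis mT : measurable_fun setT T.
Hypothesis invT : map_invariant T P.
Variable Z : (nat -> R) -> Prop.
Hypothesis nullZ : null_mode Z.
(** Differences telescope under Folner averaging, whereas ordinary convergence to 0 does not satisfy
    this; the theorem is accordingly used only in the averaging mode. *)
Hypothesis nullB : forall s M, (forall j, `|s j| <= M) -> Z (fun j => s j.+1 - s j).
Implicit Types f g h u : Y -> R.

(** Parallelogram law: [(f - g)^2 = 2 f^2 + 2 g^2 - 4 ((f + g) / 2)^2]. Near-minimizers of the [L^2]
    norm in a midpoint-convex set are therefore close. *)
Lemma mean_sqr_sub f g a : bmeas f -> bmeas g ->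
  mean P (fun x => f x ^+ 2) <= a -> mean P (fun x => g x ^+ 2) <= a ->
  mean P (fun x => (f x - g x) ^+ 2) <=
  4 * (a - mean P (fun x => (2^-1 * f x + 2^-1 * g x) ^+ 2)).
Proof.
move=> bf bg fa ga; have b2 h : bmeas h -> bmeas (fun x => h x ^+ 2).
  by move=> bh; congr bmeas: (bmeasM _ _ bh bh).
have bm : bmeas (fun x => 2^-1 * f x + 2^-1 * g x) by exact/bmeas_lin/bmeasZ.
rewrite (_ : (fun x => (f x - g x) ^+ 2) = fun x => 2 * f x ^+ 2 +
  (2 * g x ^+ 2 + -4 * (2^-1 * f x + 2^-1 * g x) ^+ 2)); last first.
  by apply/funext => x; field.
rewrite mean_lin; [|exact: b2|exact/bmeas_lin/bmeasZ/b2/bm/b2].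
rewrite mean_lin; [|exact: b2|exact/bmeasZ/b2].
rewrite meanZ; [lra|exact: b2].
Qed.

(** Passes from [L^2] to [L^1] by the pointwise bound [y <= a + y^2 / a], a consequence of
    [(a - y)^2 >= 0]; choosing [a] of the order of the [L^2] norm loses only a constant. *)
Lemma mean_norm_sqr f a : bmeas f -> 0 < a ->
  mean P (fun x => `|f x|) <= a + a^-1 * mean P (fun x => f x ^+ 2).
Proof.
move=> bf a0; have bf2 : bmeas (fun x => f x ^+ 2) by congr bmeas: (bmeasM _ _ bf bf).
rewrite -[X in X + _](mean_cst P a) -meanZ// -meanD//; last 2 first.
- exact: bmeas_cst.
- exact: bmeasZ.
apply: mean_le; first exact: bmeas_norm.
  by apply: bmeasD; [exact: bmeas_cst|exact: bmeasZ].
move=> x; rewrite -real_normK ?num_real//; set y := `|f x|.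
rewrite -(ler_pM2l a0) mulrDr mulrA divff ?gt_eqF// mul1r.
have := sqr_ge0 (a - y); have : 0 <= y * a by apply: mulr_ge0; [exact: normr_ge0|exact: ltW].
by rewrite sqrrB -expr2 mulr2n; lra.
Qed.

(** Plays the role of the closed convex hull of the orbit of [f]: functions with the same weak
    asymptotics as [f] in mode [Z]. The common sup bound [M] keeps dominated convergence
    available. *)
Let admissible f M g := [/\ bmeas g, forall x, `|g x| <= M &
  forall u, bmeas u ->
    Z (fun j => mean P (fun x => (f (iter j T x) - g (iter j T x)) * u x))].

Lemma admissible_mid f M g h : bmeas f -> admissible f M g -> admissible f M h ->
  admissible f M (fun x => 2^-1 * g x + 2^-1 * h x).
Proof.
move=> bf [bg gM gZ] [bh hM hZ]; split.
- exact/bmeas_lin/bmeasZ.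
- move=> x; rewrite (le_trans (ler_normD _ _))// !normrM.
  have -> : `|2^-1 : R| = 2^-1 by rewrite ger0_norm ?invr_ge0.
  by have := gM x; have := hM x; lra.
- move=> u bu; have Z0 := null_lin _ nullZ (-1) _ _ (hZ u bu) (hZ u bu).
  have := null_lin _ nullZ (2^-1) _ _ (gZ u bu)
    (null_lin _ nullZ 2^-1 _ _ (hZ u bu) Z0).
  congr Z; apply/funext => j.
  have bfj := bmeas_iter T mT _ j bf.
  have bgj := bmeas_iter T mT _ j bg.
  have bhj := bmeas_iter T mT _ j bh.
  have bGj : bmeas (fun x => (f (iter j T x) - g (iter j T x)) * u x).
    by apply: bmeasM => //; exact: bmeasB.
  have bHj : bmeas (fun x => (f (iter j T x) - h (iter j T x)) * u x).
    by apply: bmeasM => //; exact: bmeasB.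
  rewrite mulN1r addNr addr0 -!meanZ// -meanD; [|exact: bmeasZ..].
  by congr mean; apply/funext => x; field.
Qed.

(** Replacing [g] by [g \o T] changes the tested sequence by a difference [s j.+1 - s j] of a
    bounded sequence, null by [nullB]. *)
Lemma admissible_comp f M g : bmeas f -> admissible f M g -> admissible f M (g \o T).
Proof.
move=> bf [bg gM gZ]; split; first exact: bmeas_comp.
  by move=> x; exact: gM.
move=> u bu; have [K K0 uK] := bmeas_bound _ bu.
pose s j := mean P (fun x => g (iter j T x) * u x).
have sM j : `|s j| <= M * K.
  have bgj := bmeas_iter T mT _ j bg.
  rewrite (le_trans (mean_normM P _ _ _ bgj bu uK))// ler_wpM2r//; first exact: ltW.
  rewrite -[leRHS](mean_cst P); apply: mean_le => //; first exact: bmeas_norm.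
  exact: bmeas_cst.
have := null_lin _ nullZ (-1) _ _ (nullB _ _ sM) (gZ u bu).
congr Z; apply/funext => j; rewrite /s.
have bfj := bmeas_iter T mT _ j bf.
have bgj := bmeas_iter T mT _ j bg.
have bgj1 := bmeas_iter T mT _ j.+1 bg.
rewrite -meanB; [|exact: bmeasM..].
rewrite -meanZ; last by apply: bmeasB; exact: bmeasM.
rewrite -meanD; last 2 first.
- by apply: bmeasZ; apply: bmeasB; exact: bmeasM.
- by apply: bmeasM => //; exact: bmeasB.
by congr mean; apply/funext => x /=; ring.
Qed.

(* Among the admissible functions, an [L^2]-minimizing sequence is Cauchy by
   the parallelogram law; its limit is invariant, hence constant. *)
Theorem mean_ergodic f u : map_ergodic T P -> bmeas f -> mean P f = 0 ->
  bmeas u -> Z (fun j => mean P (fun x => f (iter j T x) * u x)).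
Proof.
move=> ergT bf Ef0 bu; have [M M0 fM] := bmeas_bound _ bf.
have Z0 : Z (fun=> 0).
  have := nullB (fun=> 0) 0; rewrite subrr; apply => j; by rewrite normr0.
have V0 : admissible f M f.
  split=> // v bv; congr Z: Z0; apply/funext => j; rewrite -[LHS](mean_cst P).
  by congr mean; apply/funext => x; rewrite subrr mul0r.
pose E := [set r | exists2 g, admissible f M g & r = mean P (fun x => g x ^+ 2)].
have E0 : lbound E 0 by move=> _ [g _ ->]; apply: mean_ge0 => x; exact: sqr_ge0.
have infE : has_inf E by split; [exists (mean P (fun x => f x ^+ 2)), f|exists 0].
have infV g : admissible f M g -> inf E <= mean P (fun x => g x ^+ 2).
  by move=> Vg; apply: ge_inf; [exists 0|exists g].
(* The excess over the infimum is the square of [2^-i], so that the [L^1] distances below are of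
   order [2^-i], hence summable. *)
have /choice[g Pg] : forall i : nat, exists g, admissible f M g /\
    mean P (fun x => g x ^+ 2) <= inf E + (2 ^+ i)^-1 ^+ 2.
  move=> i; have e0 : 0 < (2 ^+ i : R)^-1 ^+ 2 by rewrite exprn_gt0// invr_gt0 exprn_gt0.
  by have [_ [g Vg ->] /ltW gE] := inf_adherent e0 infE; exists g.
have Vg i : admissible f M (g i) by case: (Pg i).
have bg i : bmeas (g i) by case: (Vg i).
have gM i x : `|g i x| <= M by case: (Vg i).
(* With [a = 2^-i], the midpoint has squared norm at least [inf E], so the squared [L^2] distance is
   at most [4 a^2]; [mean_norm_sqr] then gives [a + 4 a = 5 a]. *)
have close i h : admissible f M h ->
    mean P (fun x => h x ^+ 2) <= inf E + (2 ^+ i)^-1 ^+ 2 ->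
    mean P (fun x => `|h x - g i x|) <= 5 / 2 ^+ i.
  move=> Vh hE; have [_ gE] := Pg i; have bh : bmeas h by case: Vh.
  set a : R := (2 ^+ i)^-1 in hE gE *.
  have a0 : 0 < a by rewrite invr_gt0 exprn_gt0.
  rewrite (le_trans (mean_norm_sqr _ a (bmeasB _ _ bh (bg i)) a0))//.
  have := mean_sqr_sub _ _ _ bh (bg i) hE gE.
  have := infV _ (admissible_mid _ _ _ _ bf Vh (Vg i)).
  set m := mean P _; set q := mean P _ => mE qm.
  have {qm mE} : q <= 4 * a ^+ 2 by lra.
  move=> qa; have : a^-1 * q <= 4 * a.
    by rewrite ler_pdivrMl// mulrCA -expr2.
  lra.
(* One series controls both the increments of [g] and its defect of invariance: [g i \o T] is
   admissible with the same norm as [g i], so [close] applies to it too. Each term contributes 5,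
   whence the constant 10. *)
pose w i x := `|g i.+1 x - g i x| + `|g i (T x) - g i x|.
have bgT i : bmeas (fun x => g i (T x)) by exact: bmeas_comp mT (bg i).
have bw i : bmeas (w i).
  by apply: bmeasD; apply: bmeas_norm; exact: bmeasB.
have [||X mX [aeX cvgX]] := ae_cvg_series P w 10 bw.
- by move=> i x; rewrite addr_ge0.
- move=> i; rewrite /w meanD; [|apply: bmeas_norm; exact: bmeasB..].
  have le1 : mean P (fun x => `|g i.+1 x - g i x|) <= 5 / 2 ^+ i.
    apply: close => //; have [_ gE] := Pg i.+1; rewrite (le_trans gE)// lerD2l.
    rewrite -!exprVn -!exprM; apply: ler_wiXn2l; rewrite ?invr_ge0// ?invf_le1// ?ler1n//.
    by rewrite leq_mul2r leqnSn orbT.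
  have le2 : mean P (fun x => `|g i (T x) - g i x|) <= 5 / 2 ^+ i.
    apply: (close i (g i \o T)); first exact: admissible_comp.
    have [_ gE] := Pg i; rewrite (le_trans _ gE)//.
    rewrite (_ : (fun x => (g i \o T) x ^+ 2) = (fun x => g i x ^+ 2) \o T)//.
    by rewrite mean_comp//; congr bmeas: (bmeasM _ _ (bg i) (bg i)).
  lra.
have w1 i x : `|g i.+1 x - g i x| <= w i x by rewrite lerDl.
have w2 i x : `|g i (T x) - g i x| <= w i x by rewrite lerDr.
have w0 i x : 0 <= w i x by rewrite addr_ge0.
have cvgg x : X x -> cvgn (g ^~ x).
  move=> Xx; have : cvgn (series (telescope (g ^~ x))).
    apply: normed_cvg; apply: series_le_cvg (cvgX x Xx) => i.
    - exact: normr_ge0.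
    - exact: w0.
    - exact: w1.
  rewrite telescopeK => /cvg_ex[l gl]; apply/cvg_ex; exists (l + g 0%N x).
  rewrite (_ : g ^~ x = fun i => (g i x - g 0%N x) + g 0%N x).
    by apply: cvgD => //; exact: cvg_cst.
  by apply/funext => i; rewrite subrK.
have cvgT x : X x -> (fun i => g i (T x) - g i x) @ \oo --> (0 : R).
  move=> /cvgX/cvg_series_cvg_0 w_0; apply: (cvg_seq_le _ _ _ w_0) => i.
  by rewrite subr0; exact: w2.
(* Cutting off by [\1_X] makes the limit exist at every point, with value 0 outside [X], so [h] is
   measurable as an everywhere limit. *)
pose h x := limn (fun i => g i x * \1_X x).
have gh x : (fun i => g i x * \1_X x) @ \oo --> h x.
  have [Xx|nX] := pselect (X x).
    apply/cvg_ex; have /cvg_ex[l gl] := cvgg x Xx; exists (l * \1_X x).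
    by apply: cvgM => //; exact: cvg_cst.
  by apply/cvg_ex; exists 0; rewrite indicE memNset//; under eq_fun do rewrite mulr0; exact: cvg_cst.
have ghX x : X x -> (fun i => g i x) @ \oo --> h x.
  by move=> Xx; have := gh x; rewrite indicE mem_set//; under eq_fun do rewrite mulr1.
have bh : bmeas h.
  apply: (bmeas_lim (fun i x => g i x * \1_X x) h M) => // [i|i x].
    by apply: bmeasM => //; exact: bmeas_indic.
  rewrite normrM indicE (le_trans _ (gM i x))// ler_piMr//.
  by case: (_ \in _); rewrite /= ?normr1 ?normr0.
have hT : {ae P, forall x, h (T x) = h x}.
  have := ae_preimage P T _ mT invT aeX; apply: filterS2 aeX => x Xx XTx.
  have : (fun i => (g i (T x) - g i x) + g i x) @ \oo --> 0 + h x.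
    by apply: cvgD; [exact: cvgT|exact: ghX].
  rewrite add0r; under eq_fun do rewrite subrK.
  by apply: cvg_unique => //; exact: ghX.
have cvgE : (fun i => mean P (fun x => `|g i x - h x|)) @ \oo --> (0 : R).
  apply: (mean_cvg P g h M) => //; apply: filterS aeX => x; exact: ghX.
(* Testing admissibility against the constant 1 gives, by invariance, the constant sequence
   [- mean P (g i)], which can be null only if it is 0. *)
have Eg i : mean P (g i) = 0.
  have [_ _ /(_ (fun=> 1) (bmeas_cst 1))] := Vg i.
  rewrite (_ : (fun j => _) = fun=> - mean P (g i)).
    by move=> /(null_cst _ nullZ) /eqP; rewrite oppr_eq0 => /eqP.
  apply/funext => j.
  have bfj := bmeas_iter T mT _ j bf; have bgj := bmeas_iter T mT _ j (bg i).
  under eq_fun do rewrite mulr1.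
  by rewrite meanB// !mean_iter// Ef0 sub0r.
have Eh : mean P h = 0.
  have : (fun i => mean P (g i)) @ \oo --> mean P h.
    apply: (cvg_seq_le _ _ _ cvgE) => i; rewrite -meanB//.
    by apply: mean_norm; exact: bmeasB.
  by under eq_fun do rewrite Eg; move=> /(cvg_unique _ (cvg_cst 0)) ->.
(* By ergodicity the set [-e < h] has measure 0 or 1. Measure 0 would make [h + e] nonpositive
   almost everywhere, against its mean [e > 0]. The lower bound suffices: once [h >= 0] almost
   everywhere, mean 0 forces [h] to vanish almost everywhere. *)
have h_ge e : 0 < e -> {ae P, forall x, - e < h x}.
  move=> e0; pose G := [set x | - e < h x].
  have mG : measurable G.
    have := @measurable_fun_ltr _ _ _ setT (fun=> - e) h (measurable_cst _) bh.1.
    by move=> /(_ measurableT [set true] I); rewrite setTI.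
  have GT : {ae P, forall x, G (T x) <-> G x}.
    by apply: filterS hT => x hx; rewrite /G /= hx.
  have [PG|PG] := ergodic_ae P T G mT invT ergT mG GT; last exact: ae_of_probability1 PG.
  have bhe : bmeas (fun x => h x + e) by apply: bmeasD => //; exact: bmeas_cst.
  have : mean P (fun x => h x + e) = mean P (fun x => -1 * `|h x + e|).
    apply: ae_eq_mean => //; first exact/bmeasZ/bmeas_norm.
    apply: filterS (ae_of_probability0 P G mG PG) => x /negP; rewrite -leNgt => he.
    by rewrite ler0_norm; [ring|lra].
  rewrite meanD//; last exact: bmeas_cst.
  rewrite meanZ ?mean_cst ?Eh; last exact: bmeas_norm.
  by have := mean_ge0 P (fun x => `|h x + e|) (fun x => normr_ge0 _); lra.
have h_ge0 : {ae P, forall x, 0 <= h x}.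
  have hn n : {ae P, forall x, - (n.+1%:R^-1) < h x} by apply: h_ge; rewrite invr_gt0.
  have := ae_foralln hn; apply: filterS => x hx; rewrite leNgt; apply/negP => h0.
  have [n] := ltr_add_invr h0; rewrite ltNge => /negP; apply.
  by rewrite -lerBlDr sub0r ltW.
have Ehn : mean P (fun x => `|h x|) = 0.
  rewrite -Eh; apply: ae_eq_mean => //; first exact: bmeas_norm.
  by apply: filterS h_ge0 => x; exact: ger0_norm.
have [K K0 uK] := bmeas_bound _ bu.
(* The sequence tested with [f - g n] is null, and it differs from the target by at most [K] times
   the [L^1] norm of [g n], uniformly in [j]; that norm is small since [g n] tends to [h], which is
   0 in [L^1]. *)
apply: (null_unif _ nullZ) => e e0.
have /cvg_seqP/(_ (e / K)) := cvgE; rewrite divr_gt0// => /(_ isT)[n /(_ n (leqnn n))].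
rewrite subr0 ger0_norm; last by apply: mean_ge0 => x.
rewrite ler_pdivlMr// => En.
exists (fun j => mean P (fun x => (f (iter j T x) - g n (iter j T x)) * u x)).
  by case: (Vg n) => _ _; exact.
move=> j; have bfj := bmeas_iter T mT _ j bf.
have bgj := bmeas_iter T mT _ j (bg n).
rewrite -meanB; last 2 first.
- exact: bmeasM.
- by apply: bmeasM => //; exact: bmeasB.
rewrite (_ : (fun x => _) = fun x => g n (iter j T x) * u x); last first.
  by apply/funext => x; ring.
rewrite (le_trans (mean_normM P _ _ _ bgj bu uK))// (le_trans _ En)//.
rewrite (mean_iter P T mT invT (fun x => `|g n x|)); last exact: bmeas_norm.
rewrite ler_wpM2r//; first exact: ltW.
rewrite -[leRHS]addr0 -Ehn -meanD; [|apply: bmeas_norm..]; last 2 first.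
- exact: bmeasB.
- by [].
apply: mean_le; first exact: bmeas_norm.
  by apply: bmeasD; apply: bmeas_norm => //; exact: bmeasB.
by move=> x; rewrite -{1}(subrK (h x) (g n x)) ler_normD.
Qed.

End mean_ergodic.

(** * Averages along Folner sequences *)

Section folner.
Context {R : realType} (F : nat -> {fset nat}).

Definition avg (s : nat -> R) (m : nat) : R := (#|` F m|%:R)^-1 * \sum_(j <- F m) s j.
Definition avg_null (s : nat -> R) : Prop := avg s @ \oo --> (0 : R).
Definition abs_null (s : nat -> R) : Prop := avg_null (fun j => `|s j|).

(** Over the union of [A] and [B], the weights of the two sums cancel except on the symmetric
    difference, where they differ by 1 in absolute value. *)
Lemma sum_sub_symdiff (s : nat -> R) M (A B : {fset nat}) :
  (forall j, `|s j| <= M) ->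
  `|\sum_(j <- A) s j - \sum_(j <- B) s j| <= M * #|` ((A `\` B) `|` (B `\` A))%fset|%:R.
Proof.
move=> sM; pose c (X : {fset nat}) j : R := s j * (j \in X)%:R.
have sumU (X V : {fset nat}) : (X `<=` V)%fset -> \sum_(j <- X) s j = \sum_(j <- V) c X j.
  move=> XV; rewrite -(big_fset_incl _ XV).
    by apply: eq_big_seq => j jX; rewrite /c jX mulr1.
  by move=> j _ /negbTE jX; rewrite /c jX mulr0.
rewrite (sumU A (A `|` B)%fset (fsubsetUl _ _)) (sumU B (A `|` B)%fset (fsubsetUr _ _)).
rewrite -sumrB -(@big_fset_incl _ _ _ _ ((A `\` B) `|` (B `\` A))%fset).
- apply: (le_trans (ler_norm_sum _ _ _)).
  rewrite (le_trans (y := \sum_(j <- ((A `\` B) `|` (B `\` A))%fset) M))//.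
    apply: ler_sum => j _; rewrite /c -mulrBr normrM (le_trans _ (sM j))// ler_piMr//.
    by case: (_ \in A); case: (_ \in B); rewrite /= ?subrr ?subr0 ?sub0r ?normrN ?normr1 ?normr0.
  by rewrite big_const_seq count_predT iter_addr addr0 mulr_natr.
- by apply/fsubsetP => j; rewrite !inE; case: (j \in A); case: (j \in B).
- by move=> j _; rewrite !inE /c; case: (j \in A); case: (j \in B); rewrite //= subrr.
Qed.

Hypothesis HF : Folner R F.

Lemma card_folner_gt0 m : 0 < (#|` F m|%:R : R).
Proof. by rewrite ltr0n cardfs_gt0; case: HF. Qed.

Lemma avg_lin a s t m : avg (fun j => a * s j + t j) m = a * avg s m + avg t m.
Proof. by rewrite /avg big_split /= -mulr_sumr mulrDr mulrCA. Qed.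

Lemma avg_cst c m : avg (fun=> c) m = c.
Proof.
rewrite /avg big_const_seq count_predT iter_addr addr0 -[c *+ _]mulr_natl mulrA mulVf ?mul1r//.
by rewrite gt_eqF// card_folner_gt0.
Qed.

Lemma avg_le s t m : (forall j, s j <= t j) -> avg s m <= avg t m.
Proof.
move=> st; rewrite /avg ler_wpM2l ?invr_ge0 ?ler0n//.
by apply: ler_sum => j _; exact: st.
Qed.

Lemma avg_norm s m : `|avg s m| <= avg (fun j => `|s j|) m.
Proof.
rewrite /avg normrM ger0_norm ?invr_ge0 ?ler0n// ler_wpM2l ?invr_ge0 ?ler0n//.
exact: ler_norm_sum.
Qed.

(** Reindexing turns the shifted sum into a sum over [shiftf (F m) 1]; the difference is then at
    most [M] times the Folner ratio for the shift by 1. *)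
Lemma avg_null_shiftB s M : (forall j, `|s j| <= M) ->
  avg_null (fun j => s j.+1 - s j).
Proof.
move=> sM; have [_ /(_ 1%N) shift0] := HF.
have : (fun m => M * (#|` ((shiftf (F m) 1 `\` F m) `|` (F m `\` shiftf (F m) 1))%fset|%:R
    / #|` F m|%:R : R)) @ \oo --> M * 0 by apply: cvgM => //; exact: cvg_cst.
rewrite mulr0 => lim0; apply: (cvg_seq_le _ _ _ lim0) => m.
rewrite subr0 /avg sumrB.
have -> : \sum_(j <- F m) s j.+1 = \sum_(j <- shiftf (F m) 1) s j.
  rewrite /shiftf big_imfset /=; last by move=> x y _ _ /addIn.
  by apply: eq_bigr => j _; rewrite addn1.
rewrite normrM ger0_norm ?invr_ge0 ?ler0n// mulrA mulrC ler_wpM2r ?invr_ge0 ?ler0n//.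
exact: sum_sub_symdiff.
Qed.

Lemma avg_null_mode : null_mode avg_null.
Proof.
split.
- move=> a s t s0 t0; rewrite /avg_null.
  rewrite (_ : avg _ = fun m => a * avg s m + avg t m); last first.
    by apply/funext => m; exact: avg_lin.
  rewrite -[X in _ --> X](addr0 (0 : R)) -[X in X + _](mulr0 a).
  by apply: cvgD => //; apply: cvgM => //; exact: cvg_cst.
- move=> s H; apply/cvg_seqP => e e0; have e2 : 0 < e / 2 by rewrite divr_gt0.
  have [t /cvg_seqP/(_ _ e2)[N tN] st] := H _ e2; exists N => m /tN.
  rewrite !subr0 => tm; have -> : s = (fun j => 1 * (s j - t j) + t j).
    by apply/funext => j; ring.
  rewrite avg_lin mul1r (le_trans (ler_normD _ _))// [leRHS](splitr e) lerD//.
  rewrite (le_trans (avg_norm _ _))// -(avg_cst (e / 2) m); exact: avg_le.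
- move=> c; rewrite /avg_null (_ : avg _ = fun=> c); last first.
    by apply/funext => m; exact: avg_cst.
  by move=> c0; apply: (cvg_unique _ (cvg_cst c) c0).
- move=> s M sM s0; have := avg_null_shiftB _ _ sM => d0; rewrite /avg_null.
  rewrite (_ : avg _ = fun m => avg (fun j => s j.+1 - s j) m + avg s m).
    by rewrite -[X in _ --> X](addr0 (0 : R)); exact: cvgD.
  apply/funext => m; rewrite -[X in X + _]mul1r -avg_lin.
  by congr avg; apply/funext => j; ring.
Qed.

Lemma avg_null_le s t : avg_null t -> (forall j, `|s j| <= t j) -> avg_null s.
Proof.
move=> t0 st; apply: (cvg_seq_le _ _ _ t0) => m; rewrite subr0.
by rewrite (le_trans (avg_norm _ _))//; exact: avg_le.
Qed.

Lemma abs_null_avg s : abs_null s -> avg_null s.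
Proof. by move=> s0; exact: avg_null_le s0 _. Qed.

Lemma abs_nullM s t M : (forall j, `|t j| <= M) -> abs_null s ->
  abs_null (fun j => s j * t j).
Proof.
move=> tM s0; have Ms0 := null_lin _ avg_null_mode M _ _ s0 (null_lin _ avg_null_mode (-1) _ _ s0 s0).
apply: (avg_null_le _ _ Ms0) => j; rewrite normr_id normrM mulN1r addNr addr0 mulrC.
by rewrite ler_wpM2r.
Qed.

Lemma abs_null_mode : null_mode abs_null.
Proof.
have [Alin Aunif Acst Ashift] := avg_null_mode; split.
- move=> a s t s0 t0; apply: avg_null_le (Alin `|a| _ _ s0 t0) _ => j.
  by rewrite normr_id -normrM ler_normD.
- move=> s H; apply: Aunif => e /H[t t0 st]; exists (fun j => `|t j|) => // j.
  by rewrite (le_trans (ler_dist_dist _ _)).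
- by move=> c /Acst /eqP; rewrite normr_eq0 => /eqP.
- by move=> s M sM; apply: (Ashift _ M) => j; rewrite normr_id.
Qed.

(** Lets the quadratic condition of weak mixing be handled by [abs_null], whose linearity is
    immediate. One direction is [s^2 <= M |s|]; the other is a Chebyshev-type truncation. *)
Lemma abs_null_sqr s M : (forall j, `|s j| <= M) ->
  abs_null s <-> avg_null (fun j => s j ^+ 2).
Proof.
move=> sM; split=> [s0|s0].
  by apply: abs_null_avg; under eq_fun do rewrite expr2; exact: abs_nullM sM s0.
apply: (null_unif _ avg_null_mode) => e e0.
(* The part of [|s j|] above level [e]: it is within [e] of [|s j|] and bounded by
   [s j ^+ 2 / e]. *)
pose t j := `|s j| - Num.min `|s j| e.
have t0 j : 0 <= t j by rewrite subr_ge0 ge_min lexx.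
exists t; last first.
  by move=> j; rewrite /t opprB addrC subrK ger0_norm ?ge_min ?lexx ?orbT// le_min normr_ge0 ltW.
have s20 := null_lin _ avg_null_mode e^-1 _ _ s0 (null_lin _ avg_null_mode (-1) _ _ s0 s0).
apply: (avg_null_le _ _ s20) => j; rewrite mulN1r addNr addr0 ger0_norm// /t.
rewrite -ler_pdivrMl ?invr_gt0// invrK -(real_normK (num_real (s j))) expr2.
have [se|se] := leP `|s j| e; first by rewrite subrr mulr0 mulr_ge0.
have : 0 <= (`|s j| - e) ^+ 2 by exact: sqr_ge0.
by rewrite expr2 => H; nra.
Qed.

End folner.

Lemma cvg_null_mode {R : realType} : null_mode (fun s : nat -> R => s @ \oo --> (0 : R)).
Proof.
split.
- move=> a s t s0 t0; rewrite -[X in _ --> X](addr0 (0 : R)) -[X in X + _](mulr0 a).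
  by apply: cvgD => //; apply: cvgM => //; exact: cvg_cst.
- move=> s H; apply/cvg_seqP => e e0; have e2 : 0 < e / 2 by rewrite divr_gt0.
  have [t /cvg_seqP/(_ _ e2)[N tN] st] := H _ e2; exists N => m /tN.
  rewrite !subr0 => tm; rewrite -(subrK (t m) (s m)).
  by rewrite (le_trans (ler_normD _ _))// [leRHS](splitr e) lerD.
- by move=> c c0; apply: (cvg_unique _ (cvg_cst c) c0).
- by move=> s M _; rewrite -cvg_shiftS.
Qed.

(** * Mixing properties in terms of correlations *)

Section mixing.
Context {d} {Y : measurableType d} {R : realType} (P : probability Y R).
Variable T : Y -> Y.
Hypothesis mT : measurable_fun setT T.
Implicit Types f g : Y -> R.

(** Equality of the means of [p] and [p \o T] survives linear combinations and, by dominated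
    convergence, bounded limits. Used with trigonometric functions on the torus and with rectangles
    on the product. *)
Lemma invariant_mcl (S : set (Y -> R)) : S `<=` bmeas ->
  (forall B, measurable B -> mcl S (\1_B : Y -> R)) ->
  (forall p, S p -> mean P (p \o T) = mean P p) -> map_invariant T P.
Proof.
move=> Sb SI ST B mB.
have mTB : measurable (T @^-1` B) by rewrite -[X in measurable X]setTI; exact: mT.
rewrite -[LHS]fineK ?fin_num_measure// -[RHS]fineK ?fin_num_measure// -!mean_indic//.
congr (_%:E); rewrite (_ : \1_(T @^-1` B) = (\1_B : Y -> R) \o T); last first.
  by apply/funext => x; rewrite /= !indicE.
elim: (SI B mB) => [p Sp|a f g Sf IHf Sg IHg|u f M Su IHu uM uf]; first exact: ST.
  have bf := mcl_bmeas _ Sb _ Sf; have bg := mcl_bmeas _ Sb _ Sg.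
  rewrite mean_lin// -IHf -IHg -mean_lin//; exact: bmeas_comp.
have bu n := mcl_bmeas _ Sb _ (Su n); have bf := bmeas_lim _ _ _ bu uM uf.
have buT n : bmeas (u n \o T) by exact: bmeas_comp.
have bfT : bmeas (f \o T) by exact: bmeas_comp.
have lim1 : (fun n => mean P (u n)) @ \oo --> mean P f.
  apply: (cvg_seq_le _ _ _ (mean_cvg P _ _ _ bu bf uM (aeW _ uf))) => n.
  by rewrite -meanB//; apply: mean_norm; exact: bmeasB.
have lim2 : (fun n => mean P (u n)) @ \oo --> mean P (f \o T).
  have ufT x : (fun n => (u n \o T) x) @ \oo --> (f \o T) x by exact: uf.
  have uMT n x : `|(u n \o T) x| <= M by exact: uM.
  apply: (cvg_seq_le _ _ _ (mean_cvg P _ _ _ buT bfT uMT (aeW _ ufT))) => n.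
  by rewrite -IHu -meanB//; apply: mean_norm; exact: bmeasB.
by apply: (cvg_unique _ lim2 lim1).
Qed.

Hypothesis invT : map_invariant T P.

Lemma mean_centered f : bmeas f -> mean P (fun x => f x - mean P f) = 0.
Proof. by move=> bf; rewrite meanB ?mean_cst ?subrr//; exact: bmeas_cst. Qed.

Lemma corr_centered f g j : bmeas f -> bmeas g ->
  corr P T f g j = mean P (fun x => (f (iter j T x) - mean P f) * g x).
Proof.
move=> bf bg; have bfj := bmeas_iter T mT _ j bf.
rewrite /corr -meanZ// -meanB; [|exact: bmeasM|exact: bmeasZ].
by congr mean; apply/funext => x; ring.
Qed.

(** Centering [f] absorbs the product of means, and the correlations become the sequences of the
    mean ergodic theorem. *)
Lemma ergodic_corr (Z : (nat -> R) -> Prop) : null_mode Z ->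
  (forall s M, (forall j, `|s j| <= M) -> Z (fun j => s j.+1 - s j)) ->
  map_ergodic T P -> forall f g, bmeas f -> bmeas g -> Z (corr P T f g).
Proof.
move=> nullZ nullB ergT f g bf bg.
have bf0 : bmeas (fun x => f x - mean P f) by apply: bmeasB => //; exact: bmeas_cst.
have := mean_ergodic P T mT invT Z nullZ nullB _ g ergT bf0 (mean_centered _ bf) bg.
by congr Z; apply/funext => j; rewrite corr_centered.
Qed.

(** For an invariant set of measure [p], the self-correlations are constantly [p - p^2]; a null
    constant is 0, so [p] is 0 or 1. *)
Lemma corr_ergodic (Z : (nat -> R) -> Prop) : null_mode Z ->
  (forall B, measurable B -> Z (corr P T \1_B \1_B)) -> map_ergodic T P.
Proof.
move=> nullZ ZI B mB TB; have TBj j : iter j T @^-1` B = B.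
  by elim: j => //= j IH; rewrite -[RHS]IH -[in RHS]TB.
have mI := mean_indic P B mB.
have := ZI B mB; rewrite (_ : corr _ _ _ _ = fun=> fine (P B) - fine (P B) * fine (P B)).
  move=> /(null_cst _ nullZ); rewrite -[X in X - _]mulr1 -mulrBr => /eqP.
  rewrite mulf_eq0 subr_eq0 => /orP[] /eqP PB; [left|right].
    by rewrite -[LHS]fineK ?fin_num_measure// PB.
  by rewrite -[LHS]fineK ?fin_num_measure// -PB.
apply/funext => j; rewrite /corr mI; congr (_ - _); rewrite -mI; congr mean.
apply/funext => x; have -> : (\1_B : Y -> R) (iter j T x) = \1_B x.
  by rewrite !indicE -[in RHS](TBj j).
by rewrite indicE; case: (x \in B); rewrite /= ?mulr1 ?mulr0.
Qed.

Lemma corr_indic (B C : set Y) j : measurable B -> measurable C ->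
  corr P T \1_B \1_C j =
  fine (P (iter j T @^-1` B `&` C)) - fine (P B) * fine (P C).
Proof.
move=> mB mC; rewrite /corr !mean_indic//; congr (_ - _).
have [mTj _] := map_invariant_iter T P j mT invT.
rewrite -mean_indic; last first.
  by apply: measurableI => //; rewrite -[X in measurable X]setTI; exact: mTj.
by congr mean; apply/funext => x; rewrite indicI /= !indicE.
Qed.

Lemma strongly_mixing_indic : map_strongly_mixing T P <->
  forall B C, measurable B -> measurable C ->
    corr P T (\1_B : Y -> R) \1_C @ \oo --> (0 : R).
Proof.
have mI B C j : measurable B -> measurable C -> measurable (iter j T @^-1` B `&` C).
  move=> mB mC; have [mTj _] := map_invariant_iter T P j mT invT.
  by apply: measurableI => //; rewrite -[X in measurable X]setTI; exact: mTj.
split=> mixT B C mB mC.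
  have := mixT B C mB mC.
  rewrite -(fineK (fin_num_measure P B mB)) -(fineK (fin_num_measure P C mC)) -EFinM.
  move=> /fine_cvgP[_] lim; rewrite -(subrr (fine (P B) * fine (P C))).
  rewrite (_ : corr _ _ _ _ = fun j => fine (P (iter j T @^-1` B `&` C)) -
      fine (P B) * fine (P C)); last by apply/funext => j; exact: corr_indic.
  by apply: cvgB => //; exact: cvg_cst.
rewrite -(fineK (fin_num_measure P B mB)) -(fineK (fin_num_measure P C mC)) -EFinM.
apply: cvg_EFin; first by apply: nearW => j; exact/fin_num_measure/mI.
rewrite (_ : fine \o _ = fun j => corr P T \1_B \1_C j + fine (P B) * fine (P C)).
  rewrite -[X in _ --> X]add0r; apply: cvgD; [exact: mixT|exact: cvg_cst].
by apply/funext => j; rewrite corr_indic// subrK.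
Qed.

End mixing.

(** The sum counts the integers from 1 to [n] that are at most [t], so it is the integer part of
    [t]. *)
Lemma sum_indic_le {R : realType} (t : R) n : 0 <= t <= n%:R ->
  t - 1 <= \sum_(k < n) (k.+1%:R <= t)%R%:R <= t.
Proof.
move=> /andP[t0 tn].
have H m : if m%:R <= t then \sum_(k < m) (k.+1%:R <= t)%R%:R = m%:R :> R
    else t - 1 <= \sum_(k < m) (k.+1%:R <= t)%R%:R <= t.
  elim: m => [|m]; first by rewrite t0 big_ord0.
  rewrite big_ord_recr /= -natr1; case: ifP => [mt ->|mt IH]; case: ifP => m1t /=.
  - by rewrite m1t.
  - by rewrite m1t /= addr0 mt andbT; move/negbT: m1t; rewrite -ltNge; lra.
  - by move/negP: mt; case; lra.
  - by rewrite m1t /= addr0.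
have := H n; case: ifP => // nt ->; have -> : t = n%:R by apply/le_anti; rewrite tn.
by rewrite lexx andbT; lra.
Qed.

(** Strong mixing speaks of sets only, so trigonometric functions must be recovered from indicators.
    After rescaling to [[0, 1]], the average of the indicators of [n + 1] equally spaced superlevel
    sets is within [1 / (n + 1)] of the function. *)
Lemma bmeas_mcl {d} {Y : measurableType d} {R : realType} (f : Y -> R) : bmeas f ->
  mcl [set g | exists2 B, measurable B & g = \1_B] f.
Proof.
set S := (X in mcl X) => bf; have [M M0 fM] := bmeas_bound _ bf.
have SI B : measurable B -> mcl S (\1_B) by move=> mB; apply: mcl_base; exists B.
have S1 : mcl S (fun=> 1).
  by congr mcl: (SI _ measurableT); apply/funext => x; rewrite indicT.
pose g x := (f x / M + 1) / 2.
have g01 x : 0 <= g x <= 1.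
  have : `|f x / M| <= 1 by rewrite normrM (gtr0_norm (_ : 0 < M^-1)) ?invr_gt0// ler_pdivrMr// mul1r.
  by rewrite /g ler_norml => /andP[? ?]; apply/andP; split; lra.
have mg : measurable_fun setT g.
  have [+ _] := bmeas_lin (2^-1 / M) _ _ bf (bmeas_cst 2^-1).
  by congr measurable_fun; apply/funext => x; rewrite /g; field; rewrite gt_eqF.
suff Sg : mcl S g.
  have := mcl_lin _ (2 * M) _ _ Sg (mcl_cst _ S1 (- M)).
  by congr mcl; apply/funext => x; rewrite /g; field; rewrite gt_eqF.
pose A n k := [set x | k.+1%:R <= n.+1%:R * g x].
have mA n k : measurable (A n k).
  have := @measurable_fun_ler _ _ R setT (fun=> k.+1%:R) (fun x => n.+1%:R * g x)
    (measurable_cst _) (measurable_funM (measurable_cst _) mg).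
  by move=> /(_ measurableT [set true] I); rewrite setTI.
have AE n x : \sum_(k < n.+1) \1_(A n k) x =
    \sum_(k < n.+1) (k.+1%:R <= n.+1%:R * g x)%R%:R :> R.
  apply: eq_bigr => k _; rewrite indicE; congr (_%:R); congr nat_of_bool.
  by apply/idP/idP => [/set_mem//|?]; exact/mem_set.
have bound n x : n.+1%:R * g x - 1 <= \sum_(k < n.+1) \1_(A n k) x <= n.+1%:R * g x.
  have /andP[g0 g1] := g01 x.
  by rewrite AE; apply: sum_indic_le; rewrite mulr_ge0//= ler_piMr.
have lim x : (fun n => n.+1%:R^-1 * \sum_(k < n.+1) \1_(A n k) x) @ \oo --> g x.
  apply: (cvg_seq_le (fun n => n.+1%:R^-1)); first exact: cvg_harmonic.
  move=> n; have n0 : 0 < (n.+1%:R : R) by [].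
  rewrite -(ler_pM2l n0) -{1}(gtr0_norm n0) -normrM mulrBr mulrA divff ?gt_eqF// mul1r.
  by have /andP[? ?] := bound n x; rewrite ler_norml; lra.
apply: (mcl_lim _ _ _ 1 _ _ lim) => [n|n x].
  apply: mclZ; elim: (n.+1) => [|m IH].
    by congr mcl: (mclZ _ 0 _ S1); apply/funext => x; rewrite big_ord0 mul0r.
  by congr mcl: (mclD _ _ _ IH (SI _ (mA n m))); apply/funext => x; rewrite big_ord_recr.
have n0 : 0 < (n.+1%:R : R) by [].
have /andP[g0 g1] := g01 x; have /andP[_ b2] := bound n x.
rewrite ger0_norm; last by rewrite mulr_ge0 ?invr_ge0// sumr_ge0// => k _; rewrite indicE.
by rewrite ler_pdivrMl// mulr1 (le_trans b2)// ler_piMr.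
Qed.

(** * Weak mixing *)

Section weak_mixing.
Context {d} {Y : measurableType d} {R : realType} (P : probability Y R).
Implicit Types f g : Y -> R.

Definition tensor f g : Y * Y -> R := fun z => f z.1 * g z.2.

Lemma bmeas_tensor f g : bmeas f -> bmeas g -> bmeas (tensor f g).
Proof.
move=> bf bg; apply: bmeasM.
- exact: (bmeas_comp fst f measurable_fst bf).
- exact: (bmeas_comp snd g measurable_snd bg).
Qed.

Lemma mean_tensor f g : bmeas f -> bmeas g ->
  mean (P \x P)%E (tensor f g) = mean P f * mean P g.
Proof.
move=> bf bg; rewrite [LHS]/mean /Rintegral.
rewrite -(@integral12_prod_meas1 _ _ _ _ _ P P (EFin \o tensor f g)); last first.
  exact: (bmeas_integrable (P \x P)%E _ (bmeas_tensor _ _ bf bg)).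
rewrite mulrC -meanZ// /mean /Rintegral; congr fine.
apply: eq_integral => x _; rewrite /fubini_F /= /tensor /=.
under eq_integral do rewrite EFinM.
rewrite integralZl//; last exact: (bmeas_integrable P).
rewrite -[in LHS](fineK (_ : (\int[P]_y (g y)%:E)%E \is a fin_num)).
  by rewrite -EFinM mulrC.
by apply: integrable_fin_num => //; exact: (bmeas_integrable P).
Qed.

Definition rectangle_indic : set (Y * Y -> R) :=
  [set h | exists A B, [/\ measurable A, measurable B & h = tensor \1_A \1_B]].

Lemma rectangle_indic_bmeas : rectangle_indic `<=` bmeas.
Proof.
by move=> _ [A [B [mA mB ->]]]; apply: bmeas_tensor; exact: bmeas_indic.
Qed.

(** Rectangles are stable under intersection, so their indicators are multiplicative, and they
    generate the product sigma-algebra. *)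
Lemma mcl_rectangle_indic (E : set (Y * Y)) : measurable E ->
  mcl rectangle_indic (\1_E : Y * Y -> R).
Proof.
have S_bounded h : rectangle_indic h -> exists M : R, forall x, `|h x| <= M.
  by move=> /rectangle_indic_bmeas[].
have rectE A B : tensor (\1_A) (\1_B) = \1_(A `*` B) :> (Y * Y -> R).
  apply/funext => z; rewrite /tensor !indicE -natrM mulnb; congr (_%:R); congr nat_of_bool.
  by apply/andP/idP => [[/set_mem ? /set_mem ?]|/set_mem[? ?]];
    [exact/mem_set|split; exact/mem_set].
have S1 : mcl rectangle_indic (fun=> 1).
  apply: mcl_base; exists setT, setT; split => //.
  by apply/funext => z; rewrite /tensor !indicT mulr1.
have SM h k : rectangle_indic h -> rectangle_indic k ->
    mcl rectangle_indic (fun x => h x * k x).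
  move=> [A [B [mA mB ->]]] [C [D [mC mD ->]]]; apply: mcl_base.
  exists (A `&` C), (B `&` D); split; try exact: measurableI.
  by apply/funext => z; rewrite /tensor !indicI /=; ring.
rewrite measurable_prod_measurableType => mE.
apply: (smallest_sub (mcl_indic_sigma_algebra _ S_bounded S1 SM) _ mE).
by move=> _ [A mA [B mB <-]] /=; apply: mcl_base; exists A, B; rewrite rectE.
Qed.

Variable T : Y -> Y.
Hypothesis mT : measurable_fun setT T.
Hypothesis invT : map_invariant T P.

(** Convertible to the map inside [map_weakly_mixing], so ergodicity facts about it apply there
    directly. *)
Definition square_map (z : Y * Y) : Y * Y := (T z.1, T z.2).

Lemma iter_square_map j z : iter j square_map z = (iter j T z.1, iter j T z.2).
Proof. by elim: j => [|j IH] /=; [case: z|rewrite IH]. Qed.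

Lemma measurable_square_map : measurable_fun setT square_map.
Proof.
by apply: measurable_fun_pair; apply: measurableT_comp.
Qed.

Lemma square_map_invariant : map_invariant square_map (P \x P)%E.
Proof.
apply: (invariant_mcl (P \x P)%E _ measurable_square_map rectangle_indic).
- exact: rectangle_indic_bmeas.
- exact: mcl_rectangle_indic.
move=> _ [A [B [mA mB ->]]].
have bA : bmeas (\1_A : Y -> R) by exact: bmeas_indic.
have bB : bmeas (\1_B : Y -> R) by exact: bmeas_indic.
rewrite (_ : _ \o _ = tensor (\1_A \o T) (\1_B \o T))//.
by rewrite !mean_tensor ?mean_comp//; exact: bmeas_comp.
Qed.

Variable F : nat -> {fset nat}.
Hypothesis HF : Folner R F.

Lemma corr_tensor f g f' g' j : bmeas f -> bmeas g -> bmeas f' -> bmeas g' ->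
  corr (P \x P)%E square_map (tensor f g) (tensor f' g') j =
  mean P (fun x => f (iter j T x) * f' x) * mean P (fun x => g (iter j T x) * g' x)
  - (mean P f * mean P f') * (mean P g * mean P g').
Proof.
move=> bf bg bf' bg'; rewrite /corr !mean_tensor//.
rewrite (_ : (fun z => _) = tensor (fun x => f (iter j T x) * f' x)
   (fun x => g (iter j T x) * g' x)).
  rewrite mean_tensor; [by ring|apply: bmeasM => //; exact: bmeas_iter..].
by apply/funext => z; rewrite /tensor iter_square_map /=; ring.
Qed.

(* For centered [f], averaging the correlations of [f (x) f] and [g (x) g] under
   the product map averages the squares of the correlations of [f] and [g]. *)
Lemma weakly_mixing_corr : map_weakly_mixing T P ->
  forall f g, bmeas f -> bmeas g -> abs_null F (corr P T f g).
Proof.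
move=> wmT f g bf bg; have [M cM] := corr_bounded P T mT _ _ bf bg.
apply/(abs_null_sqr F HF _ _ cM).
pose f0 x := f x - mean P f.
have bf0 : bmeas f0 by apply: bmeasB => //; exact: bmeas_cst.
have := ergodic_corr (P \x P)%E square_map measurable_square_map square_map_invariant
  _ (avg_null_mode F HF) (avg_null_shiftB F HF) wmT _ _
  (bmeas_tensor _ _ bf0 bf0) (bmeas_tensor _ _ bg bg).
congr avg_null; apply/funext => j.
by rewrite corr_tensor// mean_centered// !mul0r subr0 -expr2 -corr_centered.
Qed.

Lemma corr_weakly_mixing :
  (forall B C, measurable B -> measurable C ->
     abs_null F (corr P T (\1_B : Y -> R) \1_C)) ->
  map_weakly_mixing T P.
Proof.
move=> cT; apply: (corr_ergodic (P \x P)%E square_map _ (avg_null_mode F HF)).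
move=> E mE; have mclE := mcl_rectangle_indic E mE.
apply: (corr_mcl (P \x P)%E square_map measurable_square_map square_map_invariant
  _ (avg_null_mode F HF) _ rectangle_indic_bmeas _ _ _ mclE mclE).
move=> _ _ [A [B [mA mB ->]]] [C [D [mC mD ->]]].
have bI X : measurable X -> bmeas (\1_X : Y -> R) by exact: bmeas_indic.
set a : Y -> R := \1_A; set b : Y -> R := \1_B; set c : Y -> R := \1_C.
set e : Y -> R := \1_D; apply: (abs_null_avg F).
pose q j := mean P (fun x => b (iter j T x) * e x).
have q1 j : `|q j| <= 1.
  have be : bmeas (fun x => b (iter j T x) * e x).
    by apply: bmeasM; [apply: bmeas_iter => //|]; exact: bI.
  rewrite (le_trans (mean_norm P _ be))// -[leRHS](mean_cst P).
  apply: mean_le => [||x]; [exact: bmeas_norm|exact: bmeas_cst|].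
  by rewrite normrM /b /e !indicE; do 2 case: (_ \in _);
    rewrite /= ?normr1 ?normr0 ?mulr0 ?mul0r ?mulr1 ?ler01.
(* With [p_j], [q_j] the joint means and [p], [q] the products of means, [p_j q_j - p q = (p_j - p)
   q_j + p (q_j - q)]: a null sequence times a bounded one, plus a multiple of a null one. *)
have null1 := abs_nullM F HF _ _ 1 q1 (cT A C mA mC).
have := null_lin _ (abs_null_mode F HF) (mean P a * mean P c) _ _ (cT B D mB mD) null1.
congr abs_null; apply/funext => j; rewrite corr_tensor; try exact: bI.
by rewrite /corr -/a -/b -/c -/e -/(q j); ring.
Qed.

End weak_mixing.

(** * Trigonometric functions on the torus *)

Section trigonometric.
Context {R : realType}.

Lemma cosDint (t : R) (v : int) : cos (t + 2 * pi * v%:~R) = cos t.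
Proof.
have pos (x : R) m : cos (x + 2 * pi * m%:R) = cos x.
  rewrite -[RHS](periodicn (@cosD2pi R) m); congr (cos (_ + _)).
  by rewrite -[RHS]mulr_natr mulr2n; ring.
case: v => m; first exact: pos.
by rewrite NegzE mulrNz mulrN -[in RHS](subrK (2 * pi * m.+1%:R) t) pos.
Qed.

Lemma sinDint (t : R) (v : int) : sin (t + 2 * pi * v%:~R) = sin t.
Proof. by rewrite -!cosBpihalf addrAC cosDint. Qed.

Lemma twopi_mem (t : R) : 0 <= t <= 2^-1 -> 2 * pi * t \in `[0, (pi : R)].
Proof.
move=> /andP[t0 t1]; have p0 := pi_gt0 R; rewrite in_itv /=; apply/andP; split.
  by rewrite !mulr_ge0// ltW.
have : 0 <= (pi : R) * (2^-1 - t) by rewrite mulr_ge0 ?subr_ge0// ltW.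
by rewrite mulrBr; lra.
Qed.

(** Cosine is even and strictly decreasing on [[0, pi]], so a cosine inequality expresses a distance
    inequality on half a period. *)
Lemma cos_lt_dist (r t : R) : 0 <= r <= 2^-1 -> `|t| <= 2^-1 ->
  (cos (2 * pi * r) < cos (2 * pi * t)) = (`|t| < r).
Proof.
move=> r01 t1; have p0 := pi_gt0 R.
have -> : cos (2 * pi * t) = cos (2 * pi * `|t|).
  by rewrite -[LHS]cos_norm normrM (ger0_norm (_ : 0 <= 2 * pi))// mulr_ge0// ltW.
have tm : 2 * pi * `|t| \in `[0, (pi : R)] by apply: twopi_mem; rewrite normr_ge0.
have -> := ltr_cos tm (twopi_mem _ r01).
by rewrite /= ltr_pM2l// mulr_gt0.
Qed.

Lemma cos_lt_near_int (r t : R) : 0 <= r <= 2^-1 ->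
  cos (2 * pi * r) < cos (2 * pi * t) -> exists v : int, `|t - v%:~R| < r.
Proof.
(* The nearest integer to [t], so the remainder lies in [[-1/2, 1/2]]. *)
move=> r01 rt; exists (Num.floor (t + 2^-1)).
have /andP[f1 f2] := floor_itv (t + 2^-1); set v := Num.floor _ in f1 f2 *.
rewrite intrD in f2; rewrite -cos_lt_dist//; last by rewrite ler_norml; apply/andP; split; lra.
suff -> : cos (2 * pi * (t - v%:~R)) = cos (2 * pi * t) by [].
by rewrite -(cosDint _ v); congr cos; ring.
Qed.

End trigonometric.

(** * Characters, cells and Borel sets of the torus *)

Section torus.
Context {R : realType} {n : nat}.
Implicit Types (x y : 'rV[R]_n) (k l : 'cV[int]_n) (v : 'rV[int]_n).

Lemma pairingE x k : pairing x k = \sum_i x 0 i * (k i 0)%:~R.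
Proof. by rewrite /pairing mxE; apply: eq_bigr => i _; rewrite mxE. Qed.

Lemma pairingDr x k l : pairing x (k + l) = pairing x k + pairing x l.
Proof.
by rewrite !pairingE -big_split; apply: eq_bigr => i _; rewrite mxE intrD mulrDr.
Qed.

Lemma pairingNr x k : pairing x (- k) = - pairing x k.
Proof.
by rewrite !pairingE -sumrN; apply: eq_bigr => i _; rewrite mxE mulrNz mulrN.
Qed.

Lemma pairing0r x : pairing x 0 = 0.
Proof. by rewrite pairingE big1// => i _; rewrite mxE mulr0. Qed.

Lemma pairingDl x v k :
  pairing (x + map_mx intr v) k = pairing x k + ((v *m k) 0 0)%:~R.
Proof. by rewrite /pairing mulmxDl mxE -map_mxM [in X in _ + X]mxE. Qed.

Lemma pairing_TA (A : 'M[int]_n) x k : pairing (TA R A x : 'rV[R]_n) k = pairing x (A *m k).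
Proof. by rewrite /pairing /TA -mulmxA -map_mxM. Qed.

Lemma pairing_iter (A : 'M[int]_n) j x k :
  pairing (iter j (TA R A) x : 'rV[R]_n) k = pairing x (A ^+ j *m k).
Proof.
elim: j k => [|j IH] k; first by rewrite expr0 mul1mx.
by rewrite iterS pairing_TA IH mulmxA exprSr.
Qed.

Lemma pairing_delta x (i : 'I_n) : pairing x (delta_mx i 0) = x 0 i.
Proof.
rewrite pairingE (bigD1 i)//= mxE !eqxx mulr1 big1 ?addr0// => j ji.
by rewrite mxE (negbTE ji) mulr0.
Qed.

Lemma continuous_pairing k : continuous (fun x => pairing x k).
Proof.
have -> : (fun x => pairing x k) = fun x => \sum_i x 0 i * (k i 0)%:~R.
  by apply/funext => x; exact: pairingE.
apply: continuous_big => [|i _ x]; first exact: add_continuous.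
apply: (@continuousM _ _ (fun y : 'rV[R]_n => y 0 i) (fun=> (k i 0)%:~R) x).
  exact: coord_continuous.
exact: cst_continuous.
Qed.

Lemma measurable_periodic (f : 'rV[R]_n -> R) : continuous f ->
  (forall x v, f (x + map_mx intr v) = f x) ->
  measurable_fun setT (f : torus R n -> R).
Proof.
move=> cf pf; apply: (measurability _ (RGenOInfty.measurableE R)).
move=> _ [_ [a ->] <-]; rewrite setTI; apply: sub_sigma_algebra; split.
  by move/continuousP : cf; apply; exact: interval_open.
by move=> x v; rewrite /preimage /= pf.
Qed.

(** Together with [tsin], the real and imaginary parts of the character [z^k]; the monotone class
    argument works with real-valued functions. *)
Definition tcos k : torus R n -> R := fun x => cos (2 * pi * pairing x k).
Definition tsin k : torus R n -> R := fun x => sin (2 * pi * pairing x k).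

Definition trig : set (torus R n -> R) := [set f | exists k, f = tcos k \/ f = tsin k].

Lemma trig_bmeas : trig `<=` bmeas.
Proof.
have cont k : continuous (fun x => 2 * pi * pairing x k).
  move=> x; apply: (@continuousM _ _ (fun=> 2 * pi) (fun y : 'rV[R]_n => pairing y k) x).
    exact: cst_continuous.
  exact: continuous_pairing.
move=> _ [k [->|->]]; split.
- apply: (measurable_periodic (fun x => cos (2 * pi * pairing x k))) => [x|x v].
    by apply: continuous_comp; [exact: cont|exact: continuous_cos].
  by rewrite pairingDl mulrDr cosDint.
- by exists 1 => x; exact: cos_max.
- apply: (measurable_periodic (fun x => sin (2 * pi * pairing x k))) => [x|x v].
    by apply: continuous_comp; [exact: cont|exact: continuous_sin].
  by rewrite pairingDl mulrDr sinDint.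
- by exists 1 => x; exact: sin_max.
Qed.

Lemma trig_bounded f : trig f -> exists M : R, forall x, `|f x| <= M.
Proof. by move=> /trig_bmeas[]. Qed.

Lemma tcosE k : mcl trig (tcos k).
Proof. by apply: mcl_base; exists k; left. Qed.

Lemma tsinE k : mcl trig (tsin k).
Proof. by apply: mcl_base; exists k; right. Qed.

Lemma tcos0 : tcos 0 = fun=> 1.
Proof. by apply/funext => x; rewrite /tcos pairing0r mulr0 cos0. Qed.

Lemma trig1 : mcl trig (fun=> 1).
Proof. by rewrite -tcos0; exact: tcosE. Qed.

Lemma tcosD k l x : tcos (k + l) x = tcos k x * tcos l x - tsin k x * tsin l x.
Proof. by rewrite /tcos pairingDr mulrDr cosD. Qed.

Lemma tsinD k l x : tsin (k + l) x = tsin k x * tcos l x + tcos k x * tsin l x.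
Proof. by rewrite /tsin pairingDr mulrDr sinD. Qed.

Lemma tcosN k x : tcos (- k) x = tcos k x.
Proof. by rewrite /tcos pairingNr mulrN cosN. Qed.

Lemma tsinN k x : tsin (- k) x = - tsin k x.
Proof. by rewrite /tsin pairingNr mulrN sinN. Qed.

(** Product-to-sum formulas: each product is a half sum or difference of functions of frequencies
    [k + l] and [k - l]. *)
Lemma trigM f g : trig f -> trig g -> mcl trig (fun x => f x * g x).
Proof.
have sc k l : mcl trig (fun x => tsin k x * tcos l x).
  have := mcl_lin _ 2^-1 _ _ (tsinE (k + l)) (mclZ _ 2^-1 _ (tsinE (k + - l))).
  by congr mcl; apply/funext => x; rewrite !tsinD tcosN tsinN; field.
move=> [k [->|->]] [l [->|->]].
- have := mcl_lin _ 2^-1 _ _ (tcosE (k + l)) (mclZ _ 2^-1 _ (tcosE (k + - l))).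
  by congr mcl; apply/funext => x; rewrite !tcosD tcosN tsinN; field.
- by congr mcl: (sc l k); apply/funext => x; rewrite mulrC.
- exact: sc.
- have := mcl_lin _ (- 2^-1) _ _ (tcosE (k + l)) (mclZ _ 2^-1 _ (tcosE (k + - l))).
  by congr mcl; apply/funext => x; rewrite !tcosD tcosN tsinN; field.
Qed.

(* The periodization of the open sup-norm ball of radius [1/(m+2)] around [u/(m+2)]. *)
Let cell (p : 'rV[int]_n * nat) : set (torus R n) :=
  [set y | forall i, cos (2 * pi * (p.2.+2%:R)^-1) <
    cos (2 * pi * ((y : 'rV[R]_n) 0 i - (p.1 0 i)%:~R / p.2.+2%:R))].

(** Each coordinate condition is positivity of a trigonometric polynomial, by the subtraction
    formula for cosine at a basis vector; the cell indicator is the product of these finitely many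
    indicators. *)
Lemma mcl_cell p : mcl trig (\1_(cell p) : torus R n -> R).
Proof.
pose r : R := (p.2.+2%:R)^-1; pose c i : R := (p.1 0 i)%:~R / p.2.+2%:R.
pose f i (y : torus R n) : R :=
  cos (2 * pi * ((y : 'rV[R]_n) 0 i - c i)) - cos (2 * pi * r).
have Sf i : mcl trig (f i).
  have := mcl_lin _ (cos (2 * pi * c i)) _ _ (tcosE (delta_mx i 0))
    (mcl_lin _ (sin (2 * pi * c i)) _ _ (tsinE (delta_mx i 0))
      (mcl_cst _ trig1 (- cos (2 * pi * r)))).
  congr mcl; apply/funext => y; rewrite /f /tcos /tsin pairing_delta.
  by rewrite mulrBr cosB; ring.
have := mcl_prod _ trig_bounded trig1 trigM (index_enum 'I_n) _
  (fun i => mcl_indic_gt0 _ trig_bounded trigM _ (Sf i)).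
congr mcl; apply/funext => y; rewrite indicE.
have [yp|yp] := pselect (cell p y).
  rewrite mem_set// big1// => i _; rewrite indicE mem_set//= /f subr_gt0.
  exact: yp.
have /existsNP[i /negP yi] := yp.
rewrite memNset// (bigD1 i)//= indicE memNset ?mul0r//= /f subr_gt0.
exact/negP.
Qed.

Lemma cell_sub (U : set 'rV[R]_n) x : periodic_open R n U -> U x ->
  exists p, cell p x /\ cell p `<=` U.
Proof.
move=> [oU pU] Ux; have : nbhs x U by exact: open_nbhs_nbhs.
move=> /nbhs_ballP[e /= e0 xeU].
(* Taking the radius [r = 1 / (m + 2)] ensures both [r <= 1/2], as the cosine criterion requires,
   and [2 r < e]. *)
have [m] : exists m, 0 + m.+1%:R^-1 < e / 2 by apply: ltr_add_invr; rewrite divr_gt0.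
rewrite add0r => me; pose r : R := (m.+2%:R)^-1.
have r0 : 0 < r by rewrite invr_gt0.
have r2 : r <= 2^-1 by rewrite lef_pV2 ?posrE// ler_nat.
have re : 2 * r < e.
  have rm : r <= m.+1%:R^-1 by rewrite lef_pV2 ?posrE// ler_nat.
  by rewrite -ltr_pdivlMl// mulrC (le_lt_trans rm).
have r01 : 0 <= r <= 2^-1 by rewrite r2 ltW.
(* Rounding each coordinate down to a multiple of [r] gives a grid point within [r] of [x]. *)
exists (\row_i Num.floor (m.+2%:R * x 0 i), m); split => [i|y /= yp] /=.
  rewrite mxE; set f := Num.floor _.
  have /andP[f1 f2] := floor_itv (m.+2%:R * x 0 i); rewrite -/f intrD in f1 f2.
  have d0 : 0 <= x 0 i - f%:~R / m.+2%:R.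
    by rewrite subr_ge0 ler_pdivrMr// mulrC.
  have d1 : x 0 i - f%:~R / m.+2%:R < r.
    by rewrite ltrBlDr -(ltr_pM2l (_ : 0 < m.+2%:R))// mulrDr mulrCA !divff// addrC mulr1.
  by rewrite cos_lt_dist// ger0_norm// (le_trans (ltW d1)).
(* Modulo the integer vector [v], the point [y] is within [r] of the grid point, hence within
   [2 r < e] of [x]; periodicity of [U] brings the translate back to [y]. *)
have /choice[v vP] i := cos_lt_near_int _ _ r01 (yp i).
apply/(pU _ (\row_i - v i)); apply: xeU; split => // j i; rewrite (ord1 j) /ball /=.
rewrite !mxE; have := vP i; rewrite !mxE; set f := Num.floor _ => vi.
have /andP[f1 f2] := floor_itv (m.+2%:R * x 0 i); rewrite -/f intrD in f1 f2.
have d0 : 0 <= x 0 i - f%:~R / m.+2%:R.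
  by rewrite subr_ge0 ler_pdivrMr// mulrC.
have d1 : x 0 i - f%:~R / m.+2%:R < r.
  by rewrite ltrBlDr -(ltr_pM2l (_ : 0 < m.+2%:R))// mulrDr mulrCA !divff// addrC mulr1.
move: vi d0 d1; rewrite -/r; set c := _ / _; rewrite !ltr_norml mulrNz => /andP[v1 v2] d0 d1.
by apply/andP; split; lra.
Qed.

Lemma mcl_trig_indic (B : set (torus R n)) : measurable B -> mcl trig (\1_B : torus R n -> R).
Proof.
have sI := mcl_indic_sigma_algebra _ trig_bounded trig1 trigM.
move=> mB; apply: (smallest_sub sI _ mB) => U pU /=.
(* Cells have countably many parameters, so the union of those contained in [U] is a countable one;
   codes of no cell, or of a cell not inside [U], contribute the empty set. *)
pose G (i : nat) : set (torus R n) :=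
  if @choice.unpickle ('rV[int]_n * nat)%type i is Some p
  then [set y | cell p `<=` U /\ cell p y] else set0.
have [sI0 _ sIU] := sI.
have -> : U = \bigcup_i G i.
  apply/seteqP; split => [x Ux|x [i _]].
    have [p [px pU']] := cell_sub _ _ pU Ux; exists (choice.pickle p) => //.
    by rewrite /G choice.pickleK.
  by rewrite /G; case: choice.unpickle => // p [pU' px]; exact: pU'.
apply: sIU => i; rewrite /G; case: choice.unpickle => [p|]; last exact: sI0.
have [pU'|pU'] := pselect (cell p `<=` U).
  have -> : [set y | cell p `<=` U /\ cell p y] = cell p; last exact: mcl_cell.
  by apply/seteqP; split => y; [case|].
have -> : [set y | cell p `<=` U /\ cell p y] = set0; last exact: sI0.
by apply/seteqP; split => y [].
Qed.

Lemma tcos_iter (A : 'M[int]_n) j k x : tcos k (iter j (TA R A) x) = tcos (A ^+ j *m k) x.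
Proof. by rewrite /tcos pairing_iter. Qed.

Lemma tsin_iter (A : 'M[int]_n) j k x : tsin k (iter j (TA R A) x) = tsin (A ^+ j *m k) x.
Proof. by rewrite /tsin pairing_iter. Qed.

Lemma trig_TA (A : 'M[int]_n) f : trig f -> trig (f \o TA R A).
Proof.
by move=> [k [->|->]]; exists (A *m k); [left|right]; apply/funext => x;
  rewrite /tcos /tsin /= pairing_TA.
Qed.

(** Composition with [TA] preserves trigonometric functions, hence their monotone class; the
    indicator of a preimage therefore lies in that class, all of whose members are measurable. *)
Lemma measurable_TA (A : 'M[int]_n) : measurable_fun setT (TA R A).
Proof.
move=> _ B mB; rewrite setTI.
suff : bmeas (\1_(TA R A @^-1` B) : torus R n -> R) by case => /measurable_indicP.
apply: (mcl_bmeas _ trig_bmeas).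
rewrite (_ : \1_(TA R A @^-1` B) = (\1_B : torus R n -> R) \o TA R A); last first.
  by apply/funext => x; rewrite /= !indicE.
elim: (mcl_trig_indic B mB) => [f /(trig_TA A)|a f g _ IHf _ IHg|u f M _ IHu uM uf].
- exact: mcl_base.
- exact: mcl_lin _ a _ _ IHf IHg.
- by apply: (mcl_lim _ (fun n => u n \o TA R A) _ M) => // [m x|x]; [exact: uM|exact: uf].
Qed.

End torus.

(** * Fourier coefficients *)

Section complex_sequences.
Context {R : realType}.

Lemma normc_cvg0 (a b : nat -> R) :
  (fun m => Normc.normc (Complex (a m) (b m))) @ \oo --> (0 : R) <->
  a @ \oo --> (0 : R) /\ b @ \oo --> (0 : R).
Proof.
split=> [ab|[a0 b0]].
  split; apply: (cvg_seq_le _ _ _ ab) => m; rewrite subr0 /= -sqrtr_sqr ler_sqrt.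
  - by rewrite lerDl sqr_ge0.
  - by rewrite addr_ge0 ?sqr_ge0.
  - by rewrite lerDr sqr_ge0.
  - by rewrite addr_ge0 ?sqr_ge0.
have : (fun m => `|a m| + `|b m|) @ \oo --> `|0 : R| + `|0 : R|.
  by apply: cvgD; exact: cvg_norm.
rewrite normr0 addr0 => ab; apply: (cvg_seq_le _ _ _ ab) => m.
rewrite subr0 ger0_norm ?sqrtr_ge0//= -[leRHS]ger0_norm ?addr_ge0// -sqrtr_sqr.
rewrite ler_sqrt ?sqr_ge0// sqrrD !real_normK ?num_real// lerD2r lerDl.
by rewrite mulrn_wge0// mulr_ge0.
Qed.

Lemma avg_Complex (F : nat -> {fset nat}) (a b : nat -> R) m :
  (#|` F m|%:R)^-1 * \sum_(j <- F m) Complex (a j) (b j) =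
  Complex (avg F a m) (avg F b m).
Proof.
have -> : \sum_(j <- F m) Complex (a j) (b j) =
    Complex (\sum_(j <- F m) a j) (\sum_(j <- F m) b j).
  by elim: (enum_fset (F m)) => [|j s IH]; rewrite ?big_nil// !big_cons IH.
have -> : (#|` F m|%:R : R[i])^-1 = Complex (#|` F m|%:R^-1 : R) 0.
  by rewrite -(rmorph_nat (real_complex R)) -fmorphV.
by rewrite /avg; congr Complex; rewrite mul0r ?subr0 ?addr0.
Qed.

End complex_sequences.

Section fourier.
Context {R : realType} {n : nat} (A : 'M[int]_n) (mu : probability (torus R n) R).
Implicit Types k l : 'cV[int]_n.
Local Notation T := (TA R A).
Local Notation cc k l := (corr mu T (tcos k) (tcos l)).
Local Notation ss k l := (corr mu T (tsin k) (tsin l)).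
Local Notation sc k l := (corr mu T (tsin k) (tcos l)).
Local Notation cs k l := (corr mu T (tcos k) (tsin l)).

(** With [corr_im], the real and imaginary parts of the correlation of the characters of [k] and
    [l], as [fourier_corr] shows. *)
Definition corr_re k l (j : nat) : R := cc k l j - ss k l j.
Definition corr_im k l (j : nat) : R := sc k l j + cs k l j.

Let mT : measurable_fun setT T := measurable_TA A.

Let bc k : bmeas (@tcos R n k). Proof. by apply: trig_bmeas; exists k; left. Qed.
Let bs k : bmeas (@tsin R n k). Proof. by apply: trig_bmeas; exists k; right. Qed.

Lemma fourier_corr k l j :
  fourier mu (A ^+ j *m k + l) - fourier mu k * fourier mu l =
  Complex (corr_re k l j) (corr_im k l j).
Proof.
have fE p : fourier mu p = Complex (mean mu (tcos p)) (mean mu (tsin p)) by [].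
have iterM f g : bmeas f -> bmeas g -> bmeas (fun x => f (iter j T x) * g x).
  by move=> bf bg; apply: bmeasM => //; exact: bmeas_iter.
rewrite !fE.
have -> : tcos (A ^+ j *m k + l) = (fun x => tcos k (iter j T x) * tcos l x -
    tsin k (iter j T x) * tsin l x).
  by apply/funext => x; rewrite tcosD tcos_iter tsin_iter.
have -> : tsin (A ^+ j *m k + l) = (fun x => tsin k (iter j T x) * tcos l x +
    tcos k (iter j T x) * tsin l x).
  by apply/funext => x; rewrite tsinD tcos_iter tsin_iter.
rewrite meanB; [|exact: iterM..]; rewrite meanD; [|exact: iterM..].
by rewrite /corr_re /corr_im /corr; congr Complex; ring.
Qed.

Variables (Z : (nat -> R) -> Prop) (nullZ : null_mode Z).

(** Changing [l] into [-l] flips the sign of the correlations with [tsin l], so half sums and half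
    differences separate the four real correlations. Invariance then comes from comparing [p \o T]
    with a shift of [p]. *)
Lemma null_trigP :
  (map_invariant T mu /\ forall p q, trig p -> trig q -> Z (corr mu T p q)) <->
  (forall k l, Z (corr_re k l) /\ Z (corr_im k l)).
Proof.
have linZ := null_lin _ nullZ; split=> [[_ ZT] k l|ZF].
  have Tc p : trig (@tcos R n p) by exists p; left.
  have Ts p : trig (@tsin R n p) by exists p; right.
  split.
    have := linZ (-1) _ _ (ZT _ _ (Ts k) (Ts l)) (ZT _ _ (Tc k) (Tc l)).
    by congr Z; apply/funext => j; rewrite /corr_re; ring.
  have := linZ 1 _ _ (ZT _ _ (Ts k) (Tc l)) (ZT _ _ (Tc k) (Ts l)).
  by congr Z; apply/funext => j; rewrite /corr_im; ring.
have Z0 : Z (fun=> 0).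
  have [Zr _] := ZF 0 0; have := linZ (-1) _ _ Zr Zr.
  by congr Z; apply/funext => j; ring.
have half s t u : Z s -> Z t -> (forall j, u j = 2^-1 * s j + 2^-1 * t j) -> Z u.
  move=> Zs Zt us; have := linZ 2^-1 _ _ Zs (linZ 2^-1 _ _ Zt Z0).
  by congr Z; apply/funext => j; rewrite us addr0.
have halfN s t u : Z s -> Z t -> (forall j, u j = 2^-1 * s j - 2^-1 * t j) -> Z u.
  move=> Zs Zt us; have := linZ 2^-1 _ _ Zs (linZ (- 2^-1) _ _ Zt Z0).
  by congr Z; apply/funext => j; rewrite us addr0 mulNr.
have tcosNE l : tcos (- l) = @tcos R n l by apply/funext => x; exact: tcosN.
have corrN f l j : bmeas f -> corr mu T f (tsin (- l)) j = - corr mu T f (tsin l) j.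
  move=> bf; rewrite (_ : tsin (- l) = fun x => -2 * tsin l x + tsin l x).
    by rewrite corr_linr//; ring.
  by apply/funext => x; rewrite tsinN; ring.
have ZT p q : trig p -> trig q -> Z (corr mu T p q).
  move=> [k [->|->]] [l [->|->]].
  - apply: half (ZF k l).1 (ZF k (- l)).1 _ => j.
    by rewrite /corr_re tcosNE corrN//; field.
  - apply: halfN (ZF k l).2 (ZF k (- l)).2 _ => j.
    by rewrite /corr_im tcosNE corrN//; field.
  - apply: half (ZF k l).2 (ZF k (- l)).2 _ => j.
    by rewrite /corr_im tcosNE corrN//; field.
  - apply: halfN (ZF k (- l)).1 (ZF k l).1 _ => j.
    by rewrite /corr_re tcosNE corrN//; field.
split=> //; apply: (invariant_mcl mu T mT trig trig_bmeas mcl_trig_indic) => p tp.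
have bp := trig_bmeas _ tp; have tpT := trig_TA A _ tp; have bpT := trig_bmeas _ tpT.
have t1 : @trig R n (fun=> 1) by exists 0; left; rewrite tcos0.
have [M cM] := corr_bounded mu T mT _ _ bp (bmeas_cst 1).
(* Against the constant 1, the shifted correlations of [p] and the correlations of [p \o T] share
   the term [mean (p \o T^(j+1))]; their difference is the constant [mean (p \o T) - mean p], which
   must then be 0. *)
have Z1 := null_shift _ nullZ _ _ cM (ZT _ _ tp t1).
have := linZ (-1) _ _ (ZT _ _ tpT t1) Z1.
rewrite (_ : (fun j => _) = fun=> mean mu (p \o T) - mean mu p).
  by move=> /(null_cst _ nullZ)/eqP; rewrite subr_eq0 => /eqP.
have mean1 f : mean mu (fun x => f x * 1) = mean mu f.
  by congr mean; apply/funext => x; rewrite mulr1.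
by apply/funext => j; rewrite /corr mean_cst !mulr1 !mean1 /=; ring.
Qed.

Lemma null_trig_indic : map_invariant T mu ->
  (forall p q, trig p -> trig q -> Z (corr mu T p q)) ->
  forall B C, measurable B -> measurable C ->
    Z (corr mu T (\1_B : torus R n -> R) \1_C).
Proof.
move=> invT ZT B C mB mC.
by apply: (corr_mcl mu T mT invT Z nullZ trig trig_bmeas ZT); exact: mcl_trig_indic.
Qed.

End fourier.

(** * The three Fourier criteria *)

Theorem theorem4p1 (R : realType) (n : nat) (A : 'M[int]_n)
  (F : nat -> {fset nat}) (HF : Folner R F)
  (mu : probability (torus R n) R) :
  ((map_invariant (TA R A) mu /\ map_ergodic (TA R A) mu) <->
    (forall k l : 'cV[int]_n,
       ccvg (fun m => (#|` F m|%:R)^-1 *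
                      \sum_(j <- F m) fourier mu (A ^+ j *m k + l))
            (fourier mu k * fourier mu l)))
  /\
  ((map_invariant (TA R A) mu /\ map_weakly_mixing (TA R A) mu) <->
    (forall k l : 'cV[int]_n,
       (fun m => (#|` F m|%:R)^-1 *
          \sum_(j <- F m)
             Normc.normc (fourier mu (A ^+ j *m k + l)
                          - fourier mu k * fourier mu l) ^+ 2)
         @ \oo --> (0 : R)))
  /\
  ((map_invariant (TA R A) mu /\ map_strongly_mixing (TA R A) mu) <->
    (forall k l : 'cV[int]_n,
       ccvg (fun j => fourier mu (A ^+ j *m k + l))
            (fourier mu k * fourier mu l))).
Proof.
have mT := measurable_TA (R := R) A.
split; [|split].
- have E k l : ccvg (fun m => (#|` F m|%:R)^-1 *
        \sum_(j <- F m) fourier mu (A ^+ j *m k + l)) (fourier mu k * fourier mu l) <->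
      avg_null F (corr_re A mu k l) /\ avg_null F (corr_im A mu k l).
    rewrite /ccvg /avg_null -normc_cvg0.
    suff -> : (fun m => Normc.normc ((#|` F m|%:R)^-1 *
        \sum_(j <- F m) fourier mu (A ^+ j *m k + l) - fourier mu k * fourier mu l)) =
      (fun m => Normc.normc (Complex (avg F (corr_re A mu k l) m)
        (avg F (corr_im A mu k l) m))) by [].
    apply/funext => m; rewrite -avg_Complex; congr Normc.normc.
    under [in RHS]eq_bigr do rewrite -fourier_corr.
    (* The product of the two coefficients is its own average, as [F m] is nonempty. *)
    rewrite sumrB big_const_seq count_predT iter_addr addr0 mulrBr; congr (_ - _).
    rewrite -[fourier mu k * fourier mu l *+ _]mulr_natl mulKf// pnatr_eq0.
    by rewrite -lt0n cardfs_gt0; case: HF.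
  split=> [[invT ergT] k l|ZF].
    apply/E; move: k l; apply/(null_trigP A mu _ (avg_null_mode F HF)); split=> // p q tp tq.
    apply: (ergodic_corr mu (TA R A) mT invT _ (avg_null_mode F HF)
      (avg_null_shiftB F HF) ergT); exact: trig_bmeas.
  have [invT ZT] : _ /\ _ := (null_trigP A mu _ (avg_null_mode F HF)).2 (fun k l => (E k l).1 (ZF k l)).
  split=> //; apply: (corr_ergodic mu (TA R A) _ (avg_null_mode F HF)) => B mB.
  exact: (null_trig_indic A mu _ (avg_null_mode F HF)).
- have E k l : (fun m => (#|` F m|%:R)^-1 * \sum_(j <- F m) Normc.normc
        (fourier mu (A ^+ j *m k + l) - fourier mu k * fourier mu l) ^+ 2)
         @ \oo --> (0 : R) <->
      abs_null F (corr_re A mu k l) /\ abs_null F (corr_im A mu k l).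
    have bc p : bmeas (@tcos R n p) by apply: trig_bmeas; exists p; left.
    have bs p : bmeas (@tsin R n p) by apply: trig_bmeas; exists p; right.
    have cb f g := corr_bounded mu (TA R A) mT f g.
    have [M1 c1] := cb _ _ (bc k) (bc l); have [M2 c2] := cb _ _ (bs k) (bs l).
    have [M3 c3] := cb _ _ (bs k) (bc l); have [M4 c4] := cb _ _ (bc k) (bs l).
    have reM j : `|corr_re A mu k l j| <= M1 + M2.
      by rewrite (le_trans (ler_normB _ _))// lerD.
    have imM j : `|corr_im A mu k l j| <= M3 + M4.
      by rewrite (le_trans (ler_normD _ _))// lerD.
    (* The squared modulus is the sum of the squares of the two parts; being nonnegative, both
       squares have null averages exactly when their sum does. *)
    have := abs_null_sqr F HF _ _ reM; have := abs_null_sqr F HF _ _ imM => -> ->.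
    rewrite (_ : (fun m => _) = avg F (fun j => corr_re A mu k l j ^+ 2 +
        corr_im A mu k l j ^+ 2)); last first.
      apply/funext => m; congr (_ * _); apply: eq_bigr => j _.
      by rewrite fourier_corr /= sqr_sqrtr// addr_ge0 ?sqr_ge0.
    split=> [ri0|[r0 i0]].
      by split; apply: (avg_null_le F _ _ ri0) => j; rewrite ger0_norm ?sqr_ge0//
        ?lerDl ?lerDr sqr_ge0.
    have := null_lin _ (avg_null_mode F HF) 1 _ _ r0 i0.
    by under eq_fun do rewrite mul1r.
  split=> [[invT wmT] k l|ZF].
    apply/E; move: k l; apply/(null_trigP A mu _ (abs_null_mode F HF)); split=> // p q tp tq.
    by apply: weakly_mixing_corr => //; exact: trig_bmeas.
  have [invT ZT] : _ /\ _ := (null_trigP A mu _ (abs_null_mode F HF)).2 (fun k l => (E k l).1 (ZF k l)).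
  split=> //; apply: (corr_weakly_mixing mu (TA R A) mT invT F HF) => B C mB mC.
  exact: (null_trig_indic A mu _ (abs_null_mode F HF)).
- have E k l : ccvg (fun j => fourier mu (A ^+ j *m k + l)) (fourier mu k * fourier mu l) <->
      corr_re A mu k l @ \oo --> (0 : R) /\ corr_im A mu k l @ \oo --> (0 : R).
    rewrite /ccvg -normc_cvg0; under eq_fun do rewrite fourier_corr; by [].
  split=> [[invT /(strongly_mixing_indic mu (TA R A) mT invT) smT] k l|ZF].
    apply/E; move: k l; apply/(null_trigP A mu _ cvg_null_mode); split=> // p q tp tq.
    (* Here indicators are the generators, and trigonometric functions belong to their class by
       [bmeas_mcl]. *)
    apply: (corr_mcl mu (TA R A) mT invT _ cvg_null_mode
        [set g | exists2 B, measurable B & g = \1_B]).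
    + by move=> _ [B mB ->]; exact: bmeas_indic.
    + by move=> _ _ [B mB ->] [C mC ->]; exact: smT.
    + exact/bmeas_mcl/trig_bmeas.
    + exact/bmeas_mcl/trig_bmeas.
  have [invT ZT] : _ /\ _ := (null_trigP A mu _ cvg_null_mode).2 (fun k l => (E k l).1 (ZF k l)).
  split=> //; apply/(strongly_mixing_indic mu (TA R A) mT invT) => B C mB mC.
  exact: (null_trig_indic A mu _ cvg_null_mode).
Qed.
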